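(* Every positive integer $m$ with $m\geqslant 10^{36}$ is a sum of $8$ icosahedral numbers.
   Context: For a positive integer $n$, the $n$-th icosahedral number is $I_n=\frac{n(5n^2-5n+2)}{2}$. Repetitions are allowed in sums. *)

(* Defs.v *)
From mathcomp Require Import all_boot zify.

Set Implicit Arguments.
Unset Strict Implicit.
Unset Printing Implicit Defensive.

(* Neither operation truncates: 5 * n <= 5 * n ^ 2 for every n, and the
   product is always even (see [icosahedral_double]). *)
Definition icosahedral (n : nat) : nat :=
  (n * (5 * n ^ 2 - 5 * n + 2)) %/ 2.

Lemma icosahedral_double (n : nat) :
  2 * icosahedral n + 5 * n ^ 2 = 5 * n ^ 3 + 2 * n.
Proof.
have le5 : 5 * n <= 5 * n ^ 2 by nia.
have ev : 2 %| n * (5 * n ^ 2 - 5 * n + 2).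
  by rewrite dvdn2 oddM oddD oddB // !oddM; case: (odd n).
have -> : 2 * icosahedral n = n * (5 * n ^ 2 - 5 * n + 2).
  by rewrite mulnC divnK.
by nia.
Qed.

(* Main.v *)
Require Import Defs.
From mathcomp Require Import all_boot.
From mathcomp Require Import all_order all_algebra.
From mathcomp Require Import zify ring.

(** Write I(n) for the n-th icosahedral number, so 2 I(n) = 5 n^3 - 5 n^2 + 2 n.
    The cubic terms of a symmetric pair cancel:
      I(a + x) + I(a - x) = 2 I(a) + 5 (3 a - 1) x^2.
    Three pairs with the same centre a together with two further numbers u, v
    give 6 I(a) + 5 (3 a - 1) (x^2 + y^2 + z^2) + I(u) + I(v), so that m is
    represented as soon as N = (m - 6 I(a) - I(u) - I(v)) / (5 (3 a - 1)) is an
    integer congruent to 2 mod 4 with 0 < N <= (a - 1)^2: such an N is a sum of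
    three squares, all of whose roots are at most a - 1 in absolute value.

    Three squares ([three_squares]).  The case needed, N congruent to 2 mod 4,
    is proved without primes in progressions or reduction of ternary forms, by
    Liouville's method: theta series identities are read on coefficients, as
    identities between finite signed sums over integer points on quadrics.  The
    basic cancellation is [cone_fold].  It yields first Jacobi's two squares
    theorem for odd numbers ([two_squares_count]): the divisor sum and the
    number of representations satisfy the same recursion.  It then expresses
    the convolution of [cone], a weighted count of the solutions of
    t^2 + 2 t w - j^2 = n with |j| <= t, with the squares 4 i^2 as a product of
    two divisor sums ([cone_convolution]); by the two squares theorem the
    number of representations by three squares has the same convolution, so
    the two agree ([rep3_alt_cone]).  Finally all terms of the cone sum have
    the same sign and t = 1, w = n / 2, j = 1 is a solution ([cone_neq0]).

    Congruences ([local_solution]).  Take 3 a - 1 = 2 b^2 with b = 2^i.  What is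
    needed is I(u) + I(v) = R mod 40 b^2 with u small and v in a short interval.
    With u = 1 + 2 x and v = 4 z a Hensel argument ([hensel_pair]) solves the
    congruence modulo 4 b and at the same time makes four times the derivative in x
    congruent to 127 times the derivative in z modulo b.  Changing x by 20 b h1 and z by 5 b h2 then
    moves the sum modulo 8 b^2 by an odd multiple of 20 b (127 h1 + h2), and every
    value 127 h1 + h2 < 2 b is reached with h2 < 127 and h1 <= 2 b / 127.  These
    steps do not change the sum modulo 5, where I(n) = n makes the congruence
    linear.  So u is at most about 0.63 b^2 and v ranges over an interval whose
    length is a constant times b.

    Size ([size_window]).  Choose i with 8 b^6 <= m < 512 b^6 and start the
    interval for z at the first point where m - I(4 z) is at most 8.8 b^6.  As
    m >= 10^36 forces b >= 2^19, I(v) varies by at most 2.4 b^6 over the interval,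
    so m - I(u) - I(v) remains in the range that means 0 < N <= (a - 1)^2. *)

Set Implicit Arguments.
Unset Strict Implicit.
Unset Printing Implicit Defensive.

Import Order.TTheory GRing.Theory Num.Theory.
Local Open Scope ring_scope.

(** * Signed sums over integer boxes *)

(** The nontrivial character modulo 4; it vanishes on even integers, which lets
    it carry the parity conditions of the sums below. *)
Definition chi4 (d : int) : int :=
  if (d %% 4)%Z == 1 then 1 else if (d %% 4)%Z == 3 then -1 else 0.
Definition alt (p : int) : int := if (p %% 2)%Z == 0 then 1 else -1.

Lemma chi4N d : chi4 (- d) = - chi4 d.
Proof. rewrite /chi4. do !case: ifP; lia. Qed.

Lemma chi4B g p : chi4 (g - 2 * p) = alt p * chi4 g.
Proof. rewrite /chi4 /alt. do !case: ifP; lia. Qed.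

(** Only points where the summand is nonzero have to be matched.  This is what
    makes changes of variables possible between sums over the same box: on the
    support a quadratic equation bounds the new coordinates. *)
Lemma reindex_supp (T1 T2 : eqType) (r1 : seq T1) (r2 : seq T2)
    (f : T1 -> T2) (g : T2 -> T1) (F : T1 -> int) (G : T2 -> int) :
  uniq r1 -> uniq r2 ->
  (forall x, x \in r1 -> F x != 0 -> [/\ f x \in r2, g (f x) = x & G (f x) = F x]) ->
  (forall y, y \in r2 -> G y != 0 -> [/\ g y \in r1, f (g y) = y & F (g y) = G y]) ->
  \sum_(x <- r1) F x = \sum_(y <- r2) G y.
Proof.
move=> u1 u2 h1 h2.
have nz (T : eqType) (r : seq T) (H : T -> int) :
    \sum_(x <- r) H x = \sum_(x <- [seq x <- r | H x != 0]) H x.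
  rewrite big_filter [RHS]big_mkcond; apply: eq_bigr => x _.
  by case: eqP => [->|].
rewrite (nz _ r1) (nz _ r2).
have -> : \sum_(x <- [seq x <- r1 | F x != 0]) F x =
    \sum_(x <- [seq x <- r1 | F x != 0]) G (f x).
  apply: eq_big_seq => x; rewrite mem_filter => /andP[Fx rx].
  by have [_ _ ->] := h1 _ rx Fx.
rewrite -(big_map f xpredT G); apply: perm_big; apply: uniq_perm.
- rewrite map_inj_in_uniq ?filter_uniq // => x y.
  rewrite !mem_filter => /andP[Fx rx] /andP[Fy ry] e.
  by have [_ <- _] := h1 _ rx Fx; have [_ <- _] := h1 _ ry Fy; rewrite e.
- exact: filter_uniq.
- move=> y; apply/mapP/idP => [[x]|].
  + rewrite mem_filter => /andP[Fx rx] ->.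
    by have [k _ e] := h1 _ rx Fx; rewrite mem_filter e Fx.
  + rewrite mem_filter => /andP[Gy ry]; have [k e e2] := h2 _ ry Gy.
    by exists (g y); rewrite // mem_filter e2 Gy.
Qed.

(** Sums over all integers are replaced by sums over a symmetric box.  The bound
    B is a parameter, fixed once and much larger than the number represented, so
    that all the sums of an argument have the same range. *)
Definition box (B : nat) : seq int := [seq k%:Z - B%:Z | k <- iota 0 (B.*2.+1)].

Lemma mem_box B (x : int) : (x \in box B) = (- B%:Z <= x <= B%:Z).
Proof.
apply/mapP/idP => [[k]|h]; first by rewrite mem_iota => + ->; lia.
by exists (absz (x + B%:Z)); [rewrite mem_iota|]; lia.
Qed.

Lemma box_uniq B : uniq (box B).
Proof. by rewrite map_inj_uniq ?iota_uniq // => x y; lia. Qed.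

Lemma sum_boxN B (F : int -> int) : \sum_(x <- box B) F (- x) = \sum_(x <- box B) F x.
Proof.
apply: (@reindex_supp _ _ _ _ -%R -%R); rewrite ?box_uniq // => x;
  rewrite !mem_box opprK => h _; split=> //; lia.
Qed.
Arguments box B : simpl never.

(** * Folding a cone *)

(** The two sides differ by the sum of an odd function over - c < g < c. *)
Lemma odd_cancel B (h : int -> int) (c : int) :
  (forall g, h (- g) = - h g) -> 0 <= c -> h c = 0 ->
  \sum_(g <- box B) (if - c < g then h g else 0) =
  \sum_(g <- box B) (if c < g then h g else 0).
Proof.
move=> hN c0 hc.
pose D := \sum_(g <- box B) (if - c < g < c then h g else 0).
have D0 : D = 0.
  suff : D = - D by lia.
  rewrite {1}/D -sum_boxN /D -sumrN; apply: eq_bigr => g _.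
  by rewrite hN; case: ifP; case: ifP; lia.
rewrite -[RHS]addr0 -[X in _ = _ + X]D0 /D -big_split; apply: eq_bigr => g _ /=.
have [->|ne] := eqVneq g c; first by rewrite hc !if_same addr0.
by do !case: ifP; rewrite ?addr0 ?add0r //; lia.
Qed.

Lemma chi4_even (d : int) : (d %% 2)%Z = 0 -> chi4 d = 0.
Proof. rewrite /chi4; do !case: ifP; lia. Qed.

(** For p < 0 the points with |g| < 2 |p| cancel under g -> - g because chi4 is
    odd, which leaves the region g > 2 |p|.  There the summand is invariant under
    (s, p) -> (- s, - p), which exchanges s + 2 p > 0 and s + 2 p < 0; equality
    cannot occur for odd s. *)
Lemma cone_fold B (n : int) (E om eta : int -> int) :
  (forall s, E (- s) = E s) -> (forall s, om (- s) = om s) ->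
  (forall p, eta (- p) = eta p) -> (forall s, (s %% 2)%Z = 0 -> om s = 0) ->
  2 * \sum_(s <- box B) \sum_(p <- box B) \sum_(g <- box B)
    (if [&& 0 < s + 2 * p, 2 * p < g & E s + g * g - 4 * p * p == n]
     then om s * eta p * chi4 g else 0) =
  \sum_(s <- box B) \sum_(p <- box B) \sum_(g <- box B)
    (if (2 * `|p| < g) && (E s + g * g - 4 * p * p == n)
     then om s * eta p * chi4 g else 0).
Proof.
move=> EN omN etaN om0.
pose Psi (s p : int) := \sum_(g <- box B)
    (if (2 * `|p| < g) && (E s + g * g - 4 * p * p == n)
     then om s * eta p * chi4 g else 0).
have in1 (s p : int) : \sum_(g <- box B)
    (if [&& 0 < s + 2 * p, 2 * p < g & E s + g * g - 4 * p * p == n]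
     then om s * eta p * chi4 g else 0) = if 0 < s + 2 * p then Psi s p else 0.
  case: ifP => sp /=; last by rewrite big1.
  pose h (g : int) := if E s + g * g - 4 * p * p == n then om s * eta p * chi4 g else 0.
  have hN (g : int) : h (- g) = - h g.
    by rewrite /h mulrNN chi4N; case: ifP; rewrite ?mulrN ?oppr0.
  have := @odd_cancel B h (2 * `|p|) hN _ _.
  rewrite /h chi4_even ?mulr0 ?if_same; last by lia.
  move=> /(_ _ erefl) oc; have {oc} oc := oc ltac:(lia).
  rewrite /Psi; have [p0|p0] := leP 0 p.
    by apply: eq_bigr => g _; have -> : `|p| = p by lia.
  transitivity (\sum_(g <- box B) (if 2 * `|p| < g then h g else 0)); last first.
    by apply: eq_bigr => g _; rewrite /h; case: (2 * `|p| < g).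
  rewrite -oc; apply: eq_bigr => g _.
  have -> : - (2 * `|p|) = 2 * p by lia.
  by case: (_ < g).
have PsiN (s p : int) : Psi (- s) (- p) = Psi s p.
  rewrite /Psi; apply: eq_bigr => g _; rewrite EN omN etaN normrN.
  by have -> : E s + g * g - 4 * - p * - p = E s + g * g - 4 * p * p by ring.
have -> : \sum_(s <- box B) \sum_(p <- box B) \sum_(g <- box B)
    (if [&& 0 < s + 2 * p, 2 * p < g & E s + g * g - 4 * p * p == n]
     then om s * eta p * chi4 g else 0) =
  \sum_(s <- box B) \sum_(p <- box B) if 0 < s + 2 * p then Psi s p else 0.
  by apply: eq_bigr => s _; apply: eq_bigr => p _; exact: in1.
rewrite mulr_natl mulr2n -[X in X + _]sum_boxN.
under eq_bigr => s _ do rewrite -sum_boxN.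
rewrite -big_split; apply: eq_bigr => s _; rewrite -big_split.
apply: eq_bigr => p _ /=; rewrite PsiN -[RHS]/(Psi s p).
have [s0|s1] := eqVneq (s %% 2)%Z 0.
  have -> : Psi s p = 0.
    by rewrite /Psi big1 // => g _; rewrite om0 // !mul0r if_same.
  by rewrite !if_same.
by case: ifP => h1; case: ifP => h2; rewrite ?addr0 ?add0r //; lia.
Qed.

(** * Changes of variables in several dimensions *)

Lemma sum_pairs (S T : eqType) (r : seq S) (t : seq T) (F : S -> T -> int) :
  \sum_(x <- r) \sum_(y <- t) F x y =
  \sum_(u <- [seq (x, y) | x <- r, y <- t]) F u.1 u.2.
Proof. by rewrite big_allpairs. Qed.

Lemma reindex2 (r : seq int) (F G : int -> int -> int) (f1 f2 g1 g2 : int -> int -> int) : uniq r ->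
  (forall x y, x \in r -> y \in r -> F x y != 0 ->
     [/\ f1 x y \in r, f2 x y \in r,
         g1 (f1 x y) (f2 x y) = x, g2 (f1 x y) (f2 x y) = y &
         G (f1 x y) (f2 x y) = F x y]) ->
  (forall x y, x \in r -> y \in r -> G x y != 0 ->
     [/\ g1 x y \in r, g2 x y \in r,
         f1 (g1 x y) (g2 x y) = x, f2 (g1 x y) (g2 x y) = y &
         F (g1 x y) (g2 x y) = G x y]) ->
  \sum_(x <- r) \sum_(y <- r) F x y =
  \sum_(x <- r) \sum_(y <- r) G x y.
Proof.
move=> ur h1 h2.
rewrite !sum_pairs.
apply: (@reindex_supp _ _ _ _ (fun u => (f1 u.1 u.2, f2 u.1 u.2))
                             (fun u => (g1 u.1 u.2, g2 u.1 u.2))).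
- by apply: allpairs_uniq; rewrite ?ur // => -[? ?] [? ?].
- by apply: allpairs_uniq; rewrite ?ur // => -[? ?] [? ?].
- move=> _ /allpairsP[[x y] /= [hx hy ->]] /= /(h1 x y hx hy)[a b c d e].
  by split=> //; [exact: (allpairs_f pair a b) | rewrite c d].
- move=> _ /allpairsP[[x y] /= [hx hy ->]] /= /(h2 x y hx hy)[a b c d e].
  by split=> //; [exact: (allpairs_f pair a b) | rewrite c d].
Qed.

Lemma reindex3 (r : seq int) (F G : int -> int -> int -> int)
    (f1 f2 f3 g1 g2 g3 : int -> int -> int -> int) : uniq r ->
  (forall x y z, x \in r -> y \in r -> z \in r -> F x y z != 0 ->
     let: (a, b, c) := (f1 x y z, f2 x y z, f3 x y z) in
     [/\ [/\ a \in r, b \in r & c \in r],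
         [/\ g1 a b c = x, g2 a b c = y & g3 a b c = z] & G a b c = F x y z]) ->
  (forall x y z, x \in r -> y \in r -> z \in r -> G x y z != 0 ->
     let: (a, b, c) := (g1 x y z, g2 x y z, g3 x y z) in
     [/\ [/\ a \in r, b \in r & c \in r],
         [/\ f1 a b c = x, f2 a b c = y & f3 a b c = z] & F a b c = G x y z]) ->
  \sum_(x <- r) \sum_(y <- r) \sum_(z <- r) F x y z =
  \sum_(x <- r) \sum_(y <- r) \sum_(z <- r) G x y z.
Proof.
move=> ur h1 h2.
rewrite !sum_pairs.
pose f (u : int * int * int) :=
  (f1 u.1.1 u.1.2 u.2, f2 u.1.1 u.1.2 u.2, f3 u.1.1 u.1.2 u.2).
pose g (u : int * int * int) :=
  (g1 u.1.1 u.1.2 u.2, g2 u.1.1 u.1.2 u.2, g3 u.1.1 u.1.2 u.2).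
have u2 : uniq [seq (x, y) | x <- r, y <- r].
  by apply: allpairs_uniq; rewrite ?ur // => -[? ?] [? ?].
apply: (@reindex_supp _ _ _ _ f g).
- by apply: allpairs_uniq; rewrite ?ur // => -[? ?] [? ?].
- by apply: allpairs_uniq; rewrite ?ur // => -[? ?] [? ?].
- move=> _ /allpairsP[[q z] /= [hq hz ->]] /=; have [[x y] /= [hx hy ->]] := allpairsP hq.
  case/(h1 x y z hx hy hz) => -[a b c] [d e i] k; rewrite /f /g /= d e i k.
  by split=> //; apply: (allpairs_f pair (allpairs_f pair a b) c).
- move=> _ /allpairsP[[q z] /= [hq hz ->]] /=; have [[x y] /= [hx hy ->]] := allpairsP hq.
  case/(h2 x y z hx hy hz) => -[a b c] [d e i] k; rewrite /f /g /= d e i k.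
  by split=> //; apply: (allpairs_f pair (allpairs_f pair a b) c).
Qed.

(** * Jacobi's two squares theorem *)

Definition odd_ind (s : int) : int := if (s %% 2)%Z == 1 then 1 else 0.

Lemma sqr_bound (i n : int) : i * i <= n -> - n <= i <= n.
Proof. nia. Qed.
Lemma mul_bound (d e n : int) : 0 < d -> 0 < e -> d * e <= n -> (d <= n) && (e <= n).
Proof. nia. Qed.

Lemma chi4_odd (d : int) : chi4 d != 0 -> (d %% 2)%Z = 1.
Proof. rewrite /chi4; do !case: ifP; lia. Qed.

Lemma chi4D g p : chi4 (g + 2 * p) = alt p * chi4 g.
Proof. rewrite /chi4 /alt. do !case: ifP; lia. Qed.
Lemma altK p x : alt p * (alt p * x) = x.
Proof. rewrite /alt; case: ifP; lia. Qed.

(** In the coordinates d = g - 2 p, e = g + 2 p this sums chi4 d over the factorizations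
    m = d e with d and e congruent modulo 4; for odd m it is the sum of chi4 over
    all positive divisors, by [divsum_hecke]. *)
Definition hecke B (m : int) : int := \sum_(g <- box B) \sum_(p <- box B)
  if (2 * `|p| < g) && (g * g - 4 * p * p == m) then alt p * chi4 g else 0.

Definition divsum B (m : int) : int := \sum_(d <- box B) \sum_(e <- box B)
  if [&& 0 < d, 0 < e & d * e == m] then chi4 d else 0.

(** Factorizations with d and e incongruent modulo 4 cancel in pairs under the
    exchange of d and e. *)
Lemma divsum_hecke B (m : int) : (m %% 2)%Z = 1 -> 10 * m <= B%:Z -> divsum B m = hecke B m.
Proof.
move=> m2 mB.
pose F (d e : int) : int := if [&& 0 < d, 0 < e & d * e == m] then
   (if (d %% 4)%Z == (e %% 4)%Z then chi4 d else 0) else 0.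
pose F' (d e : int) : int := if [&& 0 < d, 0 < e & d * e == m] then
   (if (d %% 4)%Z == (e %% 4)%Z then 0 else chi4 d) else 0.
(* If d e is odd and d, e are incongruent modulo 4, then chi4 e = - chi4 d. *)
have F'0 : \sum_(d <- box B) \sum_(e <- box B) F' d e = 0.
  set S := (LHS); suff : S = - S by lia.
  rewrite {1}/S exchange_big /S /= -sumrN; apply: eq_bigr => d _.
  rewrite -sumrN; apply: eq_bigr => e _; rewrite /F' andbCA mulrC.
  case: ifP => // /and3P[d0 e0 /eqP de]; rewrite eq_sym; case: ifP => // ne.
  have [dod eod] : (d %% 2)%Z = 1 /\ (e %% 2)%Z = 1 by nia.
  rewrite /chi4; do !case: ifP; lia.
transitivity (\sum_(d <- box B) \sum_(e <- box B) F d e).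
  rewrite -[RHS]addr0 -[X in _ = _ + X]F'0 -big_split; apply: eq_bigr => d _.
  rewrite -big_split; apply: eq_bigr => e _; rewrite /F /F' /=.
  by case: ifP => _; first case: ifP => _; rewrite ?addr0 ?add0r.
apply: (@reindex2 _ _ _ (fun d e => d + 2 * ((e - d) %/ 4)%Z) (fun d e => ((e - d) %/ 4)%Z)
   (fun g p => g - 2 * p) (fun g p => g + 2 * p)); first exact: box_uniq.
  all: move=> x y; rewrite !mem_box /F.
- move=> hx hy; case: ifP => // /and3P[x0 y0 /eqP xy]; case: ifP => // /eqP xy4 cx.
  have /andP[h1 h2] := @mul_bound x y m x0 y0 ltac:(lia).
  have [p yE] : exists p : int, y = x + 4 * p by exists ((y - x) %/ 4)%Z; lia.
  have -> : ((y - x) %/ 4)%Z = p by lia.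
  split; try lia.
  rewrite ifT ?chi4D ?altK //; apply/andP; split; first by lia.
  by apply/eqP; rewrite -xy yE; ring.
- move=> hx hy; case: ifP => // /andP[x0 /eqP xy] cx.
  have xo : (x %% 2)%Z = 1 by apply: chi4_odd; move: cx; rewrite mulf_eq0; lia.
  have e : (x - 2 * y) * (x + 2 * y) = m by rewrite -xy; ring.
  have /andP[h1 h2] := @mul_bound (x - 2 * y) (x + 2 * y) m ltac:(lia) ltac:(lia) ltac:(lia).
  split; try lia.
  by rewrite ifT ?ifT ?chi4B //; lia.
Qed.

Lemma odd_indN s : odd_ind (- s) = odd_ind s.
Proof. rewrite /odd_ind; do !case: ifP; lia. Qed.
Lemma odd_ind_even (s : int) : (s %% 2)%Z = 0 -> odd_ind s = 0.
Proof. rewrite /odd_ind; case: ifP; lia. Qed.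
Lemma odd_ind_neq0 (s : int) : odd_ind s != 0 -> (s %% 2)%Z = 1.
Proof. rewrite /odd_ind; case: ifP; lia. Qed.
Lemma altN s : alt (- s) = alt s.
Proof. rewrite /alt; do !case: ifP; lia. Qed.

Lemma bound_4sqr_prod (i d e n : int) : 0 < d -> 0 < e -> 4 * i * i + 2 * (d * e) = n ->
  [&& d <= n, e <= n, - n <= i & i <= n].
Proof.
move=> d0 e0 h; have h1 := @mul_bound d e (d * e) d0 e0 (lexx _).
have h2 := @sqr_bound i (i * i) (lexx _).
have h3 : 0 < d * e by rewrite mulr_gt0.
have h4 : 0 <= i * i by nia.
lia.
Qed.
Lemma bound_3sqr (s x y n : int) : s * s + x * x + 4 * y * y = n ->
  [&& -n <= s, s <= n, - n <= x, x <= n, -n <= y & y <= n].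
Proof.
move=> h; have h2 (i : int) := @sqr_bound i (i * i) (lexx _).
have h3 (i : int) : 0 <= i * i by nia.
have := h2 s; have := h2 x; have := h2 y; have := h3 s; have := h3 x; have := h3 y.
lia.
Qed.

(** With s = 2 i + d, 2 p = e - s and g = d + 2 p the equation
    4 i^2 + 2 d e = n becomes s^2 + g^2 - 4 p^2 = n, and d, e > 0 become the
    inequalities folded by [cone_fold]. *)
Lemma divsum_recursion B (n : int) : (n %% 4)%Z = 2 -> 10 * n <= B%:Z ->
  2 * \sum_(i <- box B) \sum_(d <- box B) \sum_(e <- box B)
    (if [&& 0 < d, 0 < e & 4 * i * i + 2 * (d * e) == n] then chi4 d else 0) =
  \sum_(s <- box B) odd_ind s * hecke B (n - s * s).
Proof.
move=> n4 nB.
transitivity (\sum_(s <- box B) \sum_(p <- box B) \sum_(g <- box B)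
    (if (2 * `|p| < g) && (s * s + g * g - 4 * p * p == n)
     then odd_ind s * alt p * chi4 g else 0)); last first.
  apply: eq_bigr => s _; rewrite exchange_big mulr_sumr; apply: eq_bigr => g _.
  rewrite mulr_sumr; apply: eq_bigr => p _ /=.
  rewrite [in RHS]fun_if mulr0 mulrA; congr (if _ && _ then _ else _); lia.
rewrite -(@cone_fold B n (fun s => s * s) odd_ind alt _ odd_indN altN odd_ind_even); last by move=> s; ring.
congr (2 * _).
apply: (@reindex3 _ _ _ (fun i d e => 2 * i + d) (fun i d e => (e - 2 * i - d) %/ 2)%Z
  (fun i d e => e - 2 * i) (fun s p g => p + ((s - g) %/ 2)%Z) (fun s p g => g - 2 * p)
  (fun s p g => 2 * p + s)); first exact: box_uniq.
all: move=> x y z; rewrite !mem_box => hx hy hz; case: ifP => //.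
- move=> /and3P[y0 z0 /eqP e] cy.
  have yo := chi4_odd cy.
  have zo : (z %% 2)%Z = 1 by nia.
  have /and4P[h1 h2 h3 h4] := bound_4sqr_prod y0 z0 e.
  have [p pE] : exists p : int, z = y + 2 * p by exists ((z - y) %/ 2)%Z; lia.
  have -> : ((z - 2 * x - y) %/ 2)%Z = p - x by lia.
  split; [split; lia|split; lia|].
  have -> : z - 2 * x = y + 2 * (p - x) by lia.
  rewrite ifT.
    rewrite chi4D /odd_ind (_ : ((2 * x + y) %% 2)%Z == 1); last by lia.
    by rewrite mul1r altK.
  apply/and3P; split; [lia|lia|apply/eqP; rewrite -e pE; ring].
- move=> /and3P[y0 z0 /eqP e] cy.
  have zo : (z %% 2)%Z = 1 by apply: chi4_odd; move: cy; rewrite !mulf_eq0; lia.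
  have xo : (x %% 2)%Z = 1 by apply: odd_ind_neq0; move: cy; rewrite !mulf_eq0; lia.
  have [q qE] : exists q : int, x = z + 2 * q by exists ((x - z) %/ 2)%Z; lia.
  have -> : ((x - z) %/ 2)%Z = q by lia.
  have e2 : 4 * (y + q) * (y + q) + 2 * ((z - 2 * y) * (2 * y + x)) = n.
    by rewrite -e qE; ring.
  have /and4P[h1 h2 h3 h4] := @bound_4sqr_prod _ (z - 2 * y) (2 * y + x) n ltac:(lia) ltac:(lia) e2.
  split; [split; lia|split; lia|].
  rewrite ifT; last by apply/and3P; split; [lia|lia|apply/eqP].
  by rewrite chi4B /odd_ind xo eqxx mul1r.
Qed.

Lemma hecke_recursion B (n : int) : (n %% 4)%Z = 2 -> 10 * n <= B%:Z -> 0 < n ->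
  2 * \sum_(i <- box B) hecke B ((n - 4 * i * i) %/ 2)%Z =
  \sum_(s <- box B) odd_ind s * hecke B (n - s * s).
Proof.
move=> n4 nB n0; rewrite -divsum_recursion //; congr (2 * _); apply: eq_bigr => i _.
rewrite -divsum_hecke; [|nia|nia].
by apply: eq_bigr => d _; apply: eq_bigr => e _; congr (if [&& _, _ & _] then _ else _); lia.
Qed.

(** Representations of m as x^2 + 4 y^2 with x odd. *)
Definition rep2 B (m : int) : int := \sum_(x <- box B) \sum_(y <- box B)
  if x * x + 4 * y * y == m then odd_ind x else 0.

(** The rotation s = x + 2 y, t = x - 2 y turns 2 (x^2 + 4 y^2) into s^2 + t^2; of
    the two points (s, t) and (s, - t) exactly one comes from an odd x. *)
Lemma rep2_recursion B (n : int) : (n %% 4)%Z = 2 -> 10 * n <= B%:Z -> 0 < n ->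
  2 * \sum_(i <- box B) rep2 B ((n - 4 * i * i) %/ 2)%Z =
  \sum_(s <- box B) odd_ind s * rep2 B (n - s * s).
Proof.
move=> n4 nB n0.
pose H (s x y : int) : int :=
  if s * s + x * x + 4 * y * y == n then odd_ind s * odd_ind x else 0.
transitivity (\sum_(s <- box B) \sum_(x <- box B) \sum_(y <- box B) H s x y); last first.
  apply: eq_bigr => s _; rewrite mulr_sumr; apply: eq_bigr => g _.
  rewrite mulr_sumr; apply: eq_bigr => p _ /=.
  by rewrite [in RHS]fun_if mulr0; congr (if _ then _ else _); lia.
pose H2 (s x y : int) : int := if ((s + x) %% 4)%Z == 2 then H s x y else 0.
have HN s x y : H s (- x) y = H s x y by rewrite /H odd_indN mulrNN.
have H2E s x y : H2 s x y + H2 s (- x) y = H s x y.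
  rewrite /H2 HN /H; case: (_ == n); last by rewrite !if_same.
  by rewrite /odd_ind; case: (eqVneq (s %% 2)%Z); case: (eqVneq (x %% 2)%Z);
    case: ifP; case: ifP; lia.
transitivity (2 * \sum_(s <- box B) \sum_(x <- box B) \sum_(y <- box B) H2 s x y);
  last first.
  rewrite mulr_natl mulr2n -big_split; apply: eq_bigr => s _ /=.
  rewrite -[X in _ + X]sum_boxN -big_split; apply: eq_bigr => x _ /=.
  by rewrite -big_split; apply: eq_bigr => y _ /=.
congr (2 * _).
transitivity (\sum_(i <- box B) \sum_(x <- box B) \sum_(y <- box B)
    if 4 * i * i + 2 * (x * x + 4 * y * y) == n then odd_ind x else 0).
  apply: eq_bigr => i _; apply: eq_bigr => x _; apply: eq_bigr => y _.
  by congr (if _ then _ else _); lia.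
apply: (@reindex3 _ _ _ (fun i x y => x + 2 * y) (fun i x y => x - 2 * y)
  (fun i x y => i) (fun s x y => y) (fun s x y => (s + x) %/ 2)%Z
  (fun s x y => (s - x) %/ 4)%Z); first exact: box_uniq.
all: move=> x y z; rewrite !mem_box => hx hy hz.
- case: ifP => // /eqP e cy.
  have yo := odd_ind_neq0 cy.
  have e2 : (y + 2 * z) * (y + 2 * z) + (y - 2 * z) * (y - 2 * z) + 4 * x * x = n.
    by rewrite -e; ring.
  have /and4P[h1 h2 h3 /and3P[h4 h5 h6]] := bound_3sqr e2.
  split; [split; lia|split; lia|].
  rewrite /H2 ifT; last by lia.
  rewrite /H ifT; last by apply/eqP; rewrite -e; ring.
  by rewrite /odd_ind; do !case: ifP; lia.
- rewrite /H2; case: ifP => // s2; rewrite /H; case: ifP => // /eqP e.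
  rewrite mulf_eq0 negb_or => /andP[/odd_ind_neq0 xo /odd_ind_neq0 yo].
  have /and4P[h1 h2 h3 /and3P[h4 h5 h6]] := bound_3sqr e.
  have [p pE] : exists p : int, x = y + 4 * p by exists ((x - y) %/ 4)%Z; lia.
  have -> : ((x - y) %/ 4)%Z = p by lia.
  have -> : ((x + y) %/ 2)%Z = y + 2 * p by lia.
  split; [split; lia|split; lia|].
  rewrite ifT; last by apply/eqP; rewrite -e pE; ring.
  by rewrite /odd_ind; do !case: ifP; lia.
Qed.

Lemma sum_single (r : seq int) (F : int -> int) a : uniq r -> a \in r ->
  (forall x, x != a -> F x = 0) -> \sum_(x <- r) F x = F a.
Proof.
by move=> ur ar h; rewrite (bigD1_seq a) //= big1 ?addr0.
Qed.

Lemma hecke_eq0 B (m : int) : (m %% 4)%Z != 1 \/ m <= 0 -> hecke B m = 0.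
Proof.
move=> h; rewrite /hecke big1 // => g _; rewrite big1 // => p _.
case: ifP => // /andP[pg /eqP e]; case: (eqVneq (chi4 g) 0) => [->|/chi4_odd go].
  by rewrite mulr0.
case: h => h; first by nia.
have : (g - 2 * p) * (g + 2 * p) = m by rewrite -e; ring.
have : 0 < (g - 2 * p) * (g + 2 * p) by rewrite mulr_gt0 //; lia.
lia.
Qed.

Lemma rep2_eq0 B (m : int) : (m %% 4)%Z != 1 \/ m <= 0 -> rep2 B m = 0.
Proof.
move=> h; rewrite /rep2 big1 // => g _; rewrite big1 // => p _.
case: ifP => // /eqP e; case: (eqVneq (odd_ind g) 0) => // /odd_ind_neq0 go.
by case: h => h; nia.
Qed.

Lemma hecke_1 B : (0 < B)%N -> hecke B 1 = 1.
Proof.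
move=> B0; rewrite /hecke (sum_single (a := 1)) ?box_uniq ?mem_box //; last first.
- move=> g g1; rewrite big1 // => p _; case: ifP => // /andP[pg /eqP e].
  have e2 : (g - 2 * p) * (g + 2 * p) = 1 by apply: etrans e; ring.
  have /andP[h1 h2] := @mul_bound (g - 2 * p) (g + 2 * p) 1 ltac:(lia) ltac:(lia) ltac:(lia).
  lia.
- lia.
rewrite (sum_single (a := 0)) ?box_uniq ?mem_box //; first by lia.
by move=> p p1; case: ifP => // /andP[pg /eqP e]; lia.
Qed.

Lemma sum_box_pm1 B (F : int -> int) : (0 < B)%N ->
  (forall x, x != 1 -> x != -1 -> F x = 0) ->
  \sum_(x <- box B) F x = F 1 + F (-1).
Proof.
move=> B0 h; rewrite (bigD1_seq 1) ?box_uniq ?mem_box //=; last by lia.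
congr (_ + _); rewrite big_mkcond (sum_single (a := -1)) ?box_uniq ?mem_box //; first by lia.
by move=> x x1; case: ifP => // x2; apply: h.
Qed.

Lemma rep2_1 B : (0 < B)%N -> rep2 B 1 = 2.
Proof.
move=> B0; rewrite /rep2 sum_box_pm1 // => [|x x1 x2]; last first.
  rewrite big1 // => y _; case: ifP => // /eqP e.
  by case: (eqVneq (odd_ind x) 0) => // /odd_ind_neq0 go; nia.
by rewrite !(sum_single (a := 0)) ?box_uniq ?mem_box //; try lia; move=> y y0;
  case: ifP => // /eqP e; nia.
Qed.

(** For m = 1 mod 4 and n = m + 1 the terms s = 1 and s = - 1 of the recursion are the
    values at m, while all other terms are values at smaller odd numbers.  Both
    functions vanish outside the positive integers congruent to 1 modulo 4, so the
    recursion determines them from the value at 1. *)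
Lemma two_squares_count B (m : int) : 10 * (m + 1) <= B%:Z -> 2 * hecke B m = rep2 B m.
Proof.
move=> mB; have [h|m0] := leP m 0; first by rewrite hecke_eq0 ?rep2_eq0 //; right.
have [k mk] : exists k : nat, m = k by exists (absz m); lia.
elim/ltn_ind: k m mk mB m0 => k IH m mk mB m0.
have [m4|m4] := eqVneq (m %% 4)%Z 1; last by rewrite hecke_eq0 ?rep2_eq0 //; left.
have B0 : (0 < B)%N by lia.
have [->|m1] := eqVneq m 1; first by rewrite hecke_1 ?rep2_1.
have IHm (x : int) : x < m -> 2 * hecke B x = rep2 B x.
  move=> xm; have [h|x0] := leP x 0; first by rewrite hecke_eq0 ?rep2_eq0 //; right.
  by apply: (IH (absz x)); lia.
have := @hecke_recursion B (m + 1) ltac:(lia) mB ltac:(lia).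
have := @rep2_recursion B (m + 1) ltac:(lia) mB ltac:(lia).
have -> : \sum_(i <- box B) rep2 B ((m + 1 - 4 * i * i) %/ 2)%Z =
  2 * \sum_(i <- box B) hecke B ((m + 1 - 4 * i * i) %/ 2)%Z.
  rewrite mulr_sumr; apply: eq_bigr => i _; rewrite IHm //.
  have : 0 <= i * i by nia.
  by lia.
have -> : \sum_(s <- box B) odd_ind s * rep2 B (m + 1 - s * s) =
  \sum_(s <- box B) 2 * (odd_ind s * hecke B (m + 1 - s * s)) + 2 * (rep2 B m - 2 * hecke B m).
  rewrite [RHS]addrC; apply/(canRL (subrK _)); rewrite -sumrB sum_box_pm1 //.
    have e1 : m + 1 - 1 * 1 = m by lia.
    by rewrite mulrNN e1 /odd_ind /=; lia.
  move=> s s1 s2; case: (eqVneq (odd_ind s) 0) => [->|/odd_ind_neq0 so].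
    by rewrite !mul0r mulr0.
  by rewrite -IHm; [lia | nia].
rewrite -mulr_sumr; lia.
Qed.

(** * A cone sum and its convolution with squares *)

(** Boundary points |j| = t count half.  This keeps the weight even in j and makes it a
    difference of two half lines of the kind of [below]. *)
Definition edge (t j : int) : int :=
  (if - t <= j < t then 1 else 0) + (if - t < j <= t then 1 else 0).
Definition cone B (n : int) : int :=
  \sum_(t <- box B) \sum_(w <- box B) \sum_(j <- box B)
    if [&& 0 < t, 0 < w & t * t + 2 * (t * w) - j * j == n]
    then edge t j * odd_ind j * (chi4 t * chi4 w) else 0.

Lemma reindex1 (r : seq int) (F G : int -> int) (f g : int -> int) : uniq r ->
  (forall x, x \in r -> F x != 0 -> [/\ f x \in r, g (f x) = x & G (f x) = F x]) ->
  (forall y, y \in r -> G y != 0 -> [/\ g y \in r, f (g y) = y & F (g y) = G y]) ->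
  \sum_(x <- r) F x = \sum_(y <- r) G y.
Proof. by move=> ur; apply: reindex_supp. Qed.

Lemma bound_sqr_prod (s t w k n : int) : 0 < t -> 0 < w -> 0 <= k ->
  s * s + k + 2 * (t * w) = n -> [&& t <= n, w <= n, k <= n, - n <= s & s <= n].
Proof.
move=> t0 w0 k0 h; have h1 := @mul_bound t w (t * w) t0 w0 (lexx _).
have h2 := @sqr_bound s (s * s) (lexx _).
have h3 : 0 < t * w by rewrite mulr_gt0.
have h4 : 0 <= s * s by nia.
lia.
Qed.

(** The substitution s = 2 i + j: the square 4 i^2 absorbs - j^2. *)
Lemma cone_shift B (n t w j : int) : 10 * n <= B%:Z -> 0 < t -> 0 < w ->
  \sum_(i <- box B) (if t * t + 2 * (t * w) - j * j == n - 4 * i * i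
    then edge t j * odd_ind j * (chi4 t * chi4 w) else 0) =
  \sum_(s <- box B) (if s * s - 2 * s * j + t * t + 2 * (t * w) == n
    then edge t j * odd_ind j * odd_ind s * (chi4 t * chi4 w) else 0).
Proof.
move=> nB t0 w0.
case: (eqVneq (odd_ind j) 0) => [->|/odd_ind_neq0 jo].
  by rewrite !big1 // => i _; rewrite mulr0 !mul0r if_same.
have [cj0|cj] := boolP (edge t j == 0).
  by rewrite (eqP cj0) !big1 // => i _; rewrite !mul0r if_same.
have tj : - t <= j <= t by move: cj; rewrite /edge; do !case: ifP; lia.
have tj0 : 0 <= t * t - j * j by nia.
have bnd (i : int) : t * t + 2 * (t * w) - j * j = n - 4 * i * i ->
    [&& t <= n, w <= n, - n <= 2 * i & 2 * i <= n].
  move=> e.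
  by have /and5P[-> -> _ -> ->] := @bound_sqr_prod (2 * i) t w (t * t - j * j) n t0 w0 tj0 ltac:(lia).
apply: (@reindex1 _ _ _ (fun i => 2 * i + j) (fun s => (s - j) %/ 2)%Z).
- exact: box_uniq.
- move=> i; rewrite !mem_box => hi; case: ifP => // /eqP e _.
  have /and4P[h1 h2 h3 h4] := bnd _ e.
  split; [lia|lia|].
  rewrite ifT; first by rewrite [odd_ind (_ + _)]/odd_ind ifT ?mulr1 //; lia.
  by apply/eqP; rewrite -(addr0 n) -[RHS](subrK (4 * i * i)) addr0 -e; ring.
- move=> s; rewrite !mem_box => hs; case: ifP => // /eqP e.
  rewrite !mulf_eq0 !negb_or => /andP[/andP[_ /odd_ind_neq0 so] _].
  have [i iE] : exists i : int, s = 2 * i + j by exists ((s - j) %/ 2)%Z; lia.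
  have -> : ((s - j) %/ 2)%Z = i by lia.
  have e2 : t * t + 2 * (t * w) - j * j = n - 4 * i * i by rewrite -e iE; ring.
  have /and4P[h1 h2 h3 h4] := bnd _ e2.
  by rewrite e2 eqxx /odd_ind so eqxx mulr1; split; lia.
Qed.

(** The half weight at j = tau makes [edge] a difference of two such half lines. *)
Definition below (tau j : int) : int := (if j <= tau then 1 else 0) + (if j < tau then 1 else 0).

Lemma sum_box_double B (F : int -> int) :
  2 * \sum_(x <- box B) F x = \sum_(x <- box B) (F (- x) + F x).
Proof. by rewrite big_split sum_boxN /=; ring. Qed.

Lemma edgeE t j : 0 < t -> edge t j = below t j - below (- t) j.
Proof. by move=> t0; rewrite /edge /below; do !case: ifP; lia. Qed.
Lemma edgeN t j : edge t (- j) = edge t j.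
Proof. by rewrite /edge; do !case: ifP; lia. Qed.

(** The weights are even in s and in j, and s j is even under a common change of sign. *)
Lemma cone_half B (n t w : int) :
  \sum_(j <- box B) \sum_(s <- box B) (if s * s - 2 * s * j + t * t + 2 * (t * w) == n
    then edge t j * odd_ind j * odd_ind s * (chi4 t * chi4 w) else 0) =
  2 * \sum_(s <- box B) \sum_(j <- box B) (if (0 < s) && (s * s - 2 * s * j + t * t + 2 * (t * w) == n)
    then edge t j * odd_ind j * odd_ind s * (chi4 t * chi4 w) else 0).
Proof.
rewrite exchange_big /=.
pose H (s j : int) := if s * s - 2 * s * j + t * t + 2 * (t * w) == n
    then edge t j * odd_ind j * odd_ind s * (chi4 t * chi4 w) else 0.
have HN (s j : int) : H (- s) (- j) = H s j.
  by rewrite /H edgeN !odd_indN; congr (if _ == _ then _ else _); ring.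
pose h (s : int) := \sum_(j <- box B) H s j.
have hN s : h (- s) = h s.
  by rewrite /h -sum_boxN; apply: eq_bigr => j _; exact: HN.
have h0 : h 0 = 0 by rewrite /h big1 // => j _; rewrite /H; case: ifP => // _; rewrite (@odd_ind_even 0) // mulr0 mul0r.
transitivity (2 * \sum_(s <- box B) (if 0 < s then h s else 0)); last first.
  congr (2 * _); apply: eq_bigr => s _; case: ifP => [s0|s0]; first by apply: eq_bigr.
  by rewrite big1.
rewrite sum_box_double; apply: eq_bigr => s _.
rewrite hN -[LHS]/(h s); case: (ltrgtP s 0) => [s0|s0|->]; last by rewrite h0 oppr0 ltxx addr0.
- by rewrite oppr_gt0 s0 addr0.
- by rewrite oppr_gt0 ltNge (ltW s0) /= add0r.
Qed.

(** On the half line write j = tau - 2 |q|.  The points j < tau correspond to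
    q < 0 and the points j <= tau to q >= 0. *)
Lemma below_expand B (n s tau w : int) : 10 * n <= B%:Z -> 0 < s -> 0 < w -> tau != 0 ->
  (s %% 2)%Z = 1 -> (tau %% 2)%Z = 1 ->
  \sum_(j <- box B) (if s * s - 2 * s * j + tau * tau + 2 * (`|tau| * w) == n
    then below tau j * odd_ind j else 0) =
  \sum_(q <- box B) (if (s - tau) * (s - tau) + 4 * s * `|q| + 2 * (`|tau| * w) == n
    then 1 else 0).
Proof.
move=> nB s0 w0 tau0 so to.
(* In the new coordinates the left side is a sum of nonnegative terms, which keeps
   q and j = tau - 2 q inside the box. *)
have bnd (k : int) : 0 <= k -> (s - tau) * (s - tau) + 4 * s * k + 2 * (`|tau| * w) = n ->
   [&& k <= n, - n <= tau & tau <= n].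
  move=> k0 e; have sk : 4 * k <= 4 * s * k by nia.
  have /and5P[h1 h2 h3 h4 h5] := @bound_sqr_prod (s - tau) `|tau| w (4 * s * k) n ltac:(lia) w0 ltac:(lia) e.
  lia.
pose F1 (j : int) : int := if s * s - 2 * s * j + tau * tau + 2 * (`|tau| * w) == n
    then (if j <= tau then 1 else 0) * odd_ind j else 0.
pose F2 (j : int) : int := if s * s - 2 * s * j + tau * tau + 2 * (`|tau| * w) == n
    then (if j < tau then 1 else 0) * odd_ind j else 0.
pose H1 (q : int) : int := if (s - tau) * (s - tau) + 4 * s * `|q| + 2 * (`|tau| * w) == n
    then (if 0 <= q then 1 else 0) else 0.
pose H2 (q : int) : int := if (s - tau) * (s - tau) + 4 * s * `|q| + 2 * (`|tau| * w) == n
    then (if q < 0 then 1 else 0) else 0.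
transitivity (\sum_(j <- box B) F1 j + \sum_(j <- box B) F2 j).
  rewrite -big_split; apply: eq_bigr => j _ /=; rewrite /F1 /F2 /below.
  by case: (_ == n); rewrite ?addr0 // mulrDl.
transitivity (\sum_(q <- box B) H1 q + \sum_(q <- box B) H2 q); last first.
  rewrite -big_split; apply: eq_bigr => q _ /=; rewrite /H1 /H2.
  by case: (_ == n) => //; case: ltP.
have [u uE] : exists u : int, tau = 2 * u + 1 by exists (tau %/ 2)%Z; lia.
have key (j q : int) : j = tau - 2 * q -> 0 <= q ->
  s * s - 2 * s * j + tau * tau + 2 * (`|tau| * w) =
  (s - tau) * (s - tau) + 4 * s * q + 2 * (`|tau| * w) by move=> -> _; ring.
congr (_ + _).
- apply: (@reindex1 _ _ _ (fun j => (tau - j) %/ 2)%Z (fun q => tau - 2 * q)).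
  + exact: box_uniq.
  + move=> j; rewrite !mem_box /F1 /H1 => hj; case: ifP => // /eqP e.
    case: ifP => [jt|]; last by rewrite mul0r.
    rewrite mul1r => /odd_ind_neq0 jo.
    have [q qE] : exists q : int, j = tau - 2 * q by exists ((tau - j) %/ 2)%Z; lia.
    have -> : ((tau - j) %/ 2)%Z = q by lia.
    have q0 : 0 <= q by lia.
    have k := key j q qE q0; have /and3P[h1 h2 h3] := bnd q q0 ltac:(lia).
    split; [lia|lia|].
    by rewrite (_ : `|q| = q) ?q0; [rewrite -k e eqxx /odd_ind jo|lia].
  + move=> q; rewrite !mem_box /F1 /H1 => hq; case: ifP => // /eqP e.
    case: ifP => // q0 _; rewrite (_ : `|q| = q) in e; last by lia.
    have k := key (tau - 2 * q) q erefl q0; have /and3P[h1 h2 h3] := bnd q q0 ltac:(lia).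
    split; [lia|lia|].
    rewrite k e eqxx /odd_ind ifT; last by lia.
    by rewrite ifT //; lia.
- apply: (@reindex1 _ _ _ (fun j => - ((tau - j) %/ 2)%Z) (fun q => tau + 2 * q)).
  + exact: box_uniq.
  + move=> j; rewrite !mem_box /F2 /H2 => hj; case: ifP => // /eqP e.
    case: ifP => [jt|]; last by rewrite mul0r.
    rewrite mul1r => /odd_ind_neq0 jo.
    have [q qE] : exists q : int, j = tau - 2 * q by exists ((tau - j) %/ 2)%Z; lia.
    have -> : ((tau - j) %/ 2)%Z = q by lia.
    have q0 : 0 <= q by lia.
    have k := key j q qE q0; have /and3P[h1 h2 h3] := bnd q q0 ltac:(lia).
    split; [lia|lia|].
    rewrite (_ : `|- q| = q); last by lia.
    by rewrite -k e eqxx /odd_ind jo eqxx ifT //; lia.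
  + move=> q; rewrite !mem_box /F2 /H2 => hq; case: ifP => // /eqP e.
    case: ifP => // q0 _; rewrite (_ : `|q| = - q) in e; last by lia.
    have k := key (tau + 2 * q) (- q) ltac:(lia) ltac:(lia).
    have /and3P[h1 h2 h3] := bnd (- q) ltac:(lia) ltac:(lia).
    split; [lia|lia|].
    rewrite k e eqxx /odd_ind ifT; last by lia.
    by rewrite ifT //; lia.
Qed.

Definition sign (s : int) : int := if 0 < s then 1 else if s < 0 then -1 else 0.

Lemma sum_box_fold B (F : int -> int) : F 0 = 0 ->
  \sum_(s <- box B) F s = \sum_(s <- box B) (if 0 < s then F s + F (- s) else 0).
Proof.
move=> F0.
transitivity (\sum_(s <- box B) (if 0 < s then F s else 0) +
              \sum_(s <- box B) (if 0 < s then F (- s) else 0)).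
  rewrite -[X in _ = _ + X]sum_boxN -big_split; apply: eq_bigr => s _ /=.
  rewrite opprK oppr_gt0; case: (ltrgtP s 0) => [s0|s0|->]; rewrite ?addr0 ?add0r //.
rewrite -big_split; apply: eq_bigr => s _ /=; by case: ifP; rewrite ?addr0.
Qed.

(** The half line below - t contributes the terms of the half line below t with s
    replaced by - s and with the opposite sign. *)
Lemma cone_expand B (n t w : int) : 10 * n <= B%:Z -> 0 < t -> 0 < w ->
  \sum_(j <- box B) \sum_(i <- box B) (if t * t + 2 * (t * w) - j * j == n - 4 * i * i
    then edge t j * odd_ind j * (chi4 t * chi4 w) else 0) =
  2 * \sum_(s <- box B) \sum_(q <- box B)
   (if (s - t) * (s - t) + 4 * `|s| * `|q| + 2 * (t * w) == n
    then sign s * odd_ind s * (chi4 t * chi4 w) else 0).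
Proof.
move=> nB t0 w0.
under eq_bigr => j _ do rewrite cone_shift //.
rewrite cone_half; congr (2 * _).
case: (eqVneq (chi4 t) 0) => [->|/chi4_odd to].
  rewrite !big1 // => s _; rewrite big1 // => j _; by rewrite !mul0r mulr0 if_same.
rewrite [RHS]sum_box_fold; last by rewrite big1 // => q _; rewrite !mul0r if_same.
apply: eq_bigr => s _; case: ifP => s0 /=; last by rewrite big1.
case: (eqVneq (odd_ind s) 0) => [s1|/odd_ind_neq0 so].
  by rewrite odd_indN s1 !big1 ?addr0 // => q _; rewrite mulr0 mul0r if_same.
have -> : sign s = 1 by rewrite /sign s0.
have -> : sign (- s) = -1 by rewrite /sign oppr_gt0 oppr_lt0 s0 ltNge (ltW s0).
have os : odd_ind s = 1 by rewrite /odd_ind so.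
rewrite odd_indN os !mulr1.
transitivity ((chi4 t * chi4 w) * (\sum_(j <- box B) (if s * s - 2 * s * j + t * t + 2 * (`|t| * w) == n
    then below t j * odd_ind j else 0) - \sum_(j <- box B) (if s * s - 2 * s * j + (- t) * (- t) + 2 * (`|- t| * w) == n
    then below (- t) j * odd_ind j else 0))).
  rewrite -sumrB mulr_sumr; apply: eq_bigr => j _; rewrite mulrNN normrN (gtr0_norm t0).
  case: (_ == n); last by rewrite subr0 mulr0.
  by rewrite /= edgeE //; ring.
rewrite !below_expand //; try lia.
rewrite mulrBr !mulr_sumr -sumrN; congr (_ + _); apply: eq_bigr => q _.
  rewrite (gtr0_norm t0) (gtr0_norm s0); case: (_ == n) => /=; ring.
rewrite normrN (gtr0_norm t0) normrN (gtr0_norm s0).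
rewrite (_ : (s - - t) * (s - - t) = (- s - t) * (- s - t)); last by ring.
case: (_ == n) => /=; ring.
Qed.

(** The substitution w = s + 2 p, t = g - 2 p brings the sum into the form folded by
    [cone_fold], with the even weight chi4 |s|. *)
Lemma cone_to_hecke B (n q : int) : 10 * n <= B%:Z ->
  \sum_(s <- box B) \sum_(t <- box B) \sum_(w <- box B)
   (if [&& 0 < t, 0 < w & (s - t) * (s - t) + 4 * `|s| * `|q| + 2 * (t * w) == n]
    then sign s * odd_ind s * (chi4 t * chi4 w) else 0) =
  \sum_(s <- box B) \sum_(p <- box B) \sum_(g <- box B)
    (if [&& 0 < s + 2 * p, 2 * p < g & (s * s + 4 * `|s| * `|q|) + g * g - 4 * p * p == n]
     then chi4 `|s| * 1 * chi4 g else 0).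
Proof.
move=> nB.
have signE (s p g : int) : (s %% 2)%Z = 1 ->
    sign s * odd_ind s * (chi4 (g - 2 * p) * chi4 (s + 2 * p)) = chi4 `|s| * 1 * chi4 g.
  move=> so; rewrite chi4B chi4D (_ : odd_ind s = 1); last by rewrite /odd_ind so.
  have e1 : alt p * alt p = 1 by rewrite /alt; case: ifP.
  have e2 : sign s * chi4 s = chi4 `|s|.
    rewrite /sign; have [s0|s0] : s < 0 \/ 0 < s by lia.
      by rewrite ltNge (ltW s0) s0 ltr0_norm // chi4N mulN1r.
    by rewrite s0 gtr0_norm // mul1r.
  by rewrite -e2 !mulr1 -[RHS]mul1r -e1; ring.
apply: (@reindex3 _ _ _ (fun s t w => s) (fun s t w => (w - s) %/ 2)%Z (fun s t w => t + w - s)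
  (fun s p g => s) (fun s p g => g - 2 * p) (fun s p g => s + 2 * p)).
- exact: box_uniq.
- move=> s t w; rewrite !mem_box => hs ht hw; case: ifP => // /and3P[t0 w0 /eqP e].
  rewrite !mulf_eq0 !negb_or => /andP[/andP[_ /odd_ind_neq0 so] /andP[/chi4_odd to /chi4_odd wo]].
  have k0 : 0 <= 4 * `|s| * `|q| by rewrite !mulr_ge0.
  have /and5P[h1 h2 h3 h4 h5] := @bound_sqr_prod (s - t) t w _ n t0 w0 k0 ltac:(lia).
  have [p pE] : exists p : int, w = s + 2 * p by exists ((w - s) %/ 2)%Z; lia.
  have -> : ((w - s) %/ 2)%Z = p by lia.
  split; [split; lia|split; lia|].
  have [g gE] : exists g : int, g = t + w - s by exists (t + w - s).
  have tE : t = g - 2 * p by lia.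
  rewrite -gE tE pE ifT; first by rewrite signE.
  by apply/and3P; split; [lia|lia|apply/eqP; rewrite -e gE pE; ring].
- move=> s p g; rewrite !mem_box => hs hp hg; case: ifP => // /and3P[sp gp /eqP e].
  rewrite !mulf_eq0 !negb_or => /andP[/andP[/chi4_odd so _] /chi4_odd go].
  have e2 : (s - (g - 2 * p)) * (s - (g - 2 * p)) + 4 * `|s| * `|q| + 2 * ((g - 2 * p) * (s + 2 * p)) = n.
    by rewrite -e; ring.
  have k0 : 0 <= 4 * `|s| * `|q| by rewrite !mulr_ge0.
  have /and5P[h1 h2 h3 h4 h5] := @bound_sqr_prod _ (g - 2 * p) (s + 2 * p) _ n ltac:(lia) ltac:(lia) k0 e2.
  split; [split; lia|split; lia|].
  rewrite signE; last by lia.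
  by rewrite ifT //; apply/and3P; split; [lia|lia|apply/eqP].
Qed.

(** With h = s + 2 |q| one has s^2 + 4 s |q| = h^2 - 4 q^2, so the s-sum is again a
    divisor sum of the kind counted by [hecke]. *)
Lemma hecke_shift B (n q X : int) : 10 * n <= B%:Z -> 0 <= X ->
  \sum_(s <- box B) (if (0 < s) && (s * s + 4 * `|s| * `|q| + X == n) then chi4 `|s| else 0) =
  \sum_(h <- box B) (if (2 * `|q| < h) && (h * h - 4 * q * q + X == n) then alt q * chi4 h else 0).
Proof.
move=> nB X0.
have qq : `|q| * `|q| = q * q by nia.
have sq : alt `|q| = alt q by case: (leP 0 q) => q0; [rewrite ger0_norm|rewrite ltr0_norm ?altN].
apply: (@reindex1 _ _ _ (fun s => s + 2 * `|q|) (fun h => h - 2 * `|q|)).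
- exact: box_uniq.
- move=> s; rewrite !mem_box => hs; case: ifP => // /andP[s0 /eqP e] _.
  rewrite (gtr0_norm s0) in e *.
  have qn : 4 * `|q| <= n by nia.
  split; [nia|lia|].
  rewrite ifT; first by rewrite chi4D sq altK.
  apply/andP; split; first by lia.
  by apply/eqP; rewrite -e -mulrA -qq; ring.
- move=> h; rewrite !mem_box => hh; case: ifP => // /andP[h0 /eqP e] _.
  have e2 : (h - 2 * `|q|) * (h - 2 * `|q|) + 4 * (h - 2 * `|q|) * `|q| + X = n.
    by rewrite -e -(mulrA 4 q q) -qq; ring.
  have hq : 0 < h - 2 * `|q| by lia.
  split; [nia|lia|].
  rewrite (gtr0_norm hq) ifT; first by rewrite chi4B sq.
  by rewrite hq e2 eqxx.
Qed.

Lemma exchange_big4 (r : seq int) (F : int -> int -> int -> int -> int) :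
  \sum_(q <- r) \sum_(s <- r) \sum_(t <- r) \sum_(w <- r) F q s t w =
  \sum_(t <- r) \sum_(w <- r) \sum_(s <- r) \sum_(q <- r) F q s t w.
Proof.
under eq_bigr => q _ do rewrite exchange_big.
rewrite exchange_big; apply: eq_bigr => t _ /=.
under eq_bigr => q _ do rewrite exchange_big.
by rewrite exchange_big; apply: eq_bigr => w _ /=; rewrite exchange_big.
Qed.

Lemma cone_sum_expand B (n : int) : 10 * n <= B%:Z ->
  \sum_(i <- box B) cone B (n - 4 * i * i) =
  2 * \sum_(q <- box B) \sum_(s <- box B) \sum_(t <- box B) \sum_(w <- box B)
   (if [&& 0 < t, 0 < w & (s - t) * (s - t) + 4 * `|s| * `|q| + 2 * (t * w) == n]
    then sign s * odd_ind s * (chi4 t * chi4 w) else 0).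
Proof.
move=> nB; rewrite [in RHS]exchange_big4 mulr_sumr.
rewrite /cone exchange_big; apply: eq_bigr => t _ /=; rewrite mulr_sumr.
rewrite exchange_big; apply: eq_bigr => w _ /=; rewrite exchange_big /=.
have [/andP[t0 w0]|] := boolP ((0 < t) && (0 < w)).
  transitivity (\sum_(j <- box B) \sum_(i <- box B)
     (if t * t + 2 * (t * w) - j * j == n - 4 * i * i
      then edge t j * odd_ind j * (chi4 t * chi4 w) else 0)).
    by apply: eq_bigr => j _; apply: eq_bigr => i _; rewrite t0 w0.
  rewrite cone_expand //; congr (2 * _).
  by apply: eq_bigr => j _; apply: eq_bigr => i _; rewrite t0 w0.
move=> tw; rewrite !big1 ?mulr0 // => x _; rewrite big1 // => y _;
  by case: ifP => // /and3P[h1 h2 _]; rewrite h1 h2 in tw.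
Qed.

(** In terms of generating series: the cone sum times the theta series of 4 i^2 is
    twice the product of the series of [hecke] and of the same sum without alt. *)
Lemma cone_convolution B (n : int) : 10 * n <= B%:Z ->
  \sum_(i <- box B) cone B (n - 4 * i * i) =
  2 * \sum_(p <- box B) \sum_(g <- box B)
    (if 2 * `|p| < g then chi4 g * hecke B (n - (g * g - 4 * p * p)) else 0).
Proof.
move=> nB; rewrite cone_sum_expand //.
pose E (q s : int) : int := s * s + 4 * `|s| * `|q|.
pose Z (q s : int) := \sum_(p <- box B) \sum_(g <- box B)
  (if (2 * `|p| < g) && (E q s + g * g - 4 * p * p == n)
   then chi4 `|s| * 1 * chi4 g else 0).
transitivity (\sum_(q <- box B) \sum_(s <- box B) Z q s).
  rewrite mulr_sumr; apply: eq_bigr => q _; rewrite cone_to_hecke //.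
  rewrite (@cone_fold B n (E q) (fun s => chi4 `|s|) (fun=> 1)) // => s.
  - by rewrite /E normrN mulrNN.
  - by rewrite normrN.
  - by move=> s2; apply: chi4_even; lia.
have Z0 q : Z q 0 = 0.
  rewrite /Z big1 // => p _; rewrite big1 // => g _.
  by rewrite normr0 /= !mul0r if_same.
transitivity (2 * \sum_(q <- box B) \sum_(s <- box B) (if 0 < s then Z q s else 0)).
  rewrite mulr_sumr; apply: eq_bigr => q _; rewrite sum_box_fold // mulr_sumr.
  apply: eq_bigr => s _; case: ifP => // _.
  suff -> : Z q (- s) = Z q s by ring.
  by rewrite /Z /E !normrN mulrNN.
congr (2 * _).
transitivity (\sum_(p <- box B) \sum_(g <- box B) (if 2 * `|p| < g then
  chi4 g * \sum_(q <- box B) \sum_(s <- box B)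
   (if (0 < s) && (s * s + 4 * `|s| * `|q| + (g * g - 4 * p * p) == n) then chi4 `|s| else 0)
   else 0)).
  transitivity (\sum_(q <- box B) \sum_(s <- box B) \sum_(p <- box B) \sum_(g <- box B)
    (if [&& 0 < s, 2 * `|p| < g & E q s + (g * g - 4 * p * p) == n]
     then chi4 g * chi4 `|s| else 0)).
    apply: eq_bigr => q _; apply: eq_bigr => s _; case: ifP => s0 /=; last first.
      by rewrite big1 // => p _; rewrite big1.
    apply: eq_bigr => p _; apply: eq_bigr => g _.
    by rewrite ?s0 /= !addrA mulr1 [chi4 `|s| * _]mulrC.
  under eq_bigr => q _ do (rewrite exchange_big; under eq_bigr => p _ do rewrite exchange_big).
  rewrite exchange_big; apply: eq_bigr => p _ /=.
  rewrite exchange_big; apply: eq_bigr => g _ /=; case: ifP => pg /=; last first.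
    by rewrite big1 // => q _; rewrite big1 // => s _; rewrite andbF.
  rewrite mulr_sumr; apply: eq_bigr => q _; rewrite mulr_sumr; apply: eq_bigr => s _.
  by rewrite /E; case: ifP; rewrite ?mulr0.
apply: eq_bigr => p _; apply: eq_bigr => g _; case: ifP => // pg; congr (_ * _).
have X0 : 0 <= g * g - 4 * p * p.
  have -> : g * g - 4 * p * p = (g - 2 * p) * (g + 2 * p) by ring.
  by rewrite mulr_ge0 //; lia.
under eq_bigr => q _ do rewrite hecke_shift //.
rewrite exchange_big /hecke; apply: eq_bigr => h _; apply: eq_bigr => q _ /=.
by congr (if _ && _ then _ else _); lia.
Qed.

Lemma odd_sqr_mod8 (x : int) : (x %% 2)%Z = 1 -> exists b : int, x * x = 8 * b + 1.
Proof.
move=> xo; have [c [->|->]] : exists c : int, x = 4 * c + 1 \/ x = 4 * c + 3.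
  by exists (x %/ 4)%Z; lia.
- by exists (2 * c * c + c); ring.
- by exists (2 * c * c + 3 * c + 1); ring.
Qed.

(** * Three squares *)

Definition rep2_alt B (m : int) : int := \sum_(x <- box B) \sum_(y <- box B)
  if x * x + 4 * y * y == m then odd_ind x * alt y else 0.

(** The weight alt y is determined by x^2 + 4 y^2 modulo 8, and alt p by
    g^2 - 4 p^2 modulo 8.  Hence this is the two squares theorem multiplied by a
    sign that depends on m only. *)
Lemma rep2_alt_hecke B (m : int) : 10 * (m + 1) <= B%:Z ->
  rep2_alt B m = 2 * \sum_(p <- box B) \sum_(g <- box B)
    (if (2 * `|p| < g) && (g * g - 4 * p * p == m) then chi4 g else 0).
Proof.
move=> mB; pose e : int := if (m %% 8)%Z == 1 then 1 else -1.
transitivity (e * rep2 B m).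
  rewrite /rep2 mulr_sumr; apply: eq_bigr => x _; rewrite mulr_sumr; apply: eq_bigr => y _.
  case: ifP => [/eqP xy|]; last by rewrite mulr0.
  case: (eqVneq (odd_ind x) 0) => [->|/odd_ind_neq0 xo]; first by rewrite mulr0 mul0r.
  have [b x1] := odd_sqr_mod8 xo.
  rewrite mulrC; congr (_ * _); rewrite /alt /e.
  have [c [cE|cE]] : exists c : int, y = 2 * c \/ y = 2 * c + 1 by exists (y %/ 2)%Z; lia.
    have -> : m = 8 * (b + 2 * c * c) + 1 by rewrite -xy x1 cE; ring.
    by do !case: ifP; lia.
  have -> : m = 8 * (b + 2 * c * c + 2 * c) + 5 by rewrite -xy x1 cE; ring.
  by do !case: ifP; lia.
rewrite -two_squares_count // mulrCA /hecke exchange_big; congr (_ * _).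
rewrite mulr_sumr; apply: eq_bigr => p _; rewrite mulr_sumr; apply: eq_bigr => g _ /=.
case: ifP => [/andP[_ /eqP xy]|]; last by rewrite mulr0.
case: (eqVneq (chi4 g) 0) => [->|/chi4_odd xo]; first by rewrite !mulr0.
have [b x1] := odd_sqr_mod8 xo.
rewrite mulrA -[RHS]mul1r; congr (_ * _); rewrite /alt /e.
have [c [cE|cE]] : exists c : int, p = 2 * c \/ p = 2 * c + 1 by exists (p %/ 2)%Z; lia.
  have -> : m = 8 * (b - 2 * c * c) + 1 by rewrite -xy x1 cE; ring.
  by do !case: ifP; lia.
have -> : m = 8 * (b - 2 * c * c - 2 * c - 1) + 5 by rewrite -xy x1 cE; ring.
by do !case: ifP; lia.
Qed.

Definition rep3_alt B (n : int) : int :=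
  \sum_(x <- box B) \sum_(y <- box B) \sum_(z <- box B)
    if x * x + y * y + 4 * z * z == n then odd_ind x * odd_ind y * alt z else 0.

(** The product of two divisor sums in [cone_convolution] becomes a sum over
    quadruples x^2 + 4 y^2 + x'^2 + 4 y'^2 = n; the square 4 y^2 is then split off. *)
Lemma cone_rep3_recursion B (n : int) : 10 * (n + 1) <= B%:Z ->
  2 * \sum_(i <- box B) cone B (n - 4 * i * i) = \sum_(i <- box B) rep3_alt B (n - 4 * i * i).
Proof.
move=> nB; rewrite cone_convolution; last by lia.
transitivity (\sum_(x <- box B) \sum_(y <- box B) odd_ind x * rep2_alt B (n - x * x - 4 * y * y)).
  transitivity (2 * \sum_(x <- box B) \sum_(y <- box B) \sum_(p <- box B) \sum_(g <- box B)
     (if (2 * `|p| < g) && (x * x + 4 * y * y + (g * g - 4 * p * p) == n) then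
       chi4 g * odd_ind x else 0)).
    congr (2 * _).
    under [RHS]eq_bigr => x _ do (rewrite exchange_big; under eq_bigr => p _ do rewrite exchange_big).
    rewrite [RHS]exchange_big mulr_sumr; apply: eq_bigr => p _ /=.
    rewrite [RHS]exchange_big mulr_sumr; apply: eq_bigr => g _ /=.
    case: ifP => pg /=; last by rewrite mulr0 big1 // => x _; rewrite big1.
    rewrite mulrCA two_squares_count; last first.
      have : 0 < (g - 2 * p) * (g + 2 * p) by (rewrite mulr_gt0 //; lia).
      have -> : (g - 2 * p) * (g + 2 * p) = g * g - 4 * p * p by ring.
      lia.
    rewrite mulr_sumr; apply: eq_bigr => x _; rewrite mulr_sumr; apply: eq_bigr => y _.
    rewrite [LHS]fun_if mulr0; congr (if _ then _ else _); lia.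
  rewrite mulr_sumr; apply: eq_bigr => x _; rewrite mulr_sumr; apply: eq_bigr => y _.
  rewrite rep2_alt_hecke; last by (have : 0 <= x * x + 4 * y * y by nia); lia.
  rewrite mulrCA; congr (2 * _).
  rewrite mulr_sumr; apply: eq_bigr => p _; rewrite mulr_sumr; apply: eq_bigr => g _.
  rewrite [RHS]fun_if mulr0 [chi4 g * _]mulrC; congr (if _ && _ then _ else _); lia.
rewrite exchange_big; apply: eq_bigr => y _ /=; apply: eq_bigr => x _.
rewrite mulr_sumr; apply: eq_bigr => y' _; rewrite mulr_sumr; apply: eq_bigr => z _.
rewrite [LHS]fun_if mulr0 mulrA; congr (if _ then _ else _); lia.
Qed.

Lemma rep3_alt_nonpos B (n : int) : n <= 0 -> rep3_alt B n = 0.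
Proof.
move=> n0; rewrite /rep3_alt big1 // => x _; rewrite big1 // => y _; rewrite big1 // => z _.
case: ifP => // /eqP e; case: (eqVneq (odd_ind x) 0) => [->|/odd_ind_neq0 xo]; first by rewrite !mul0r.
nia.
Qed.

Lemma edge_bound t j : edge t j != 0 -> - t <= j <= t.
Proof. rewrite /edge; do !case: ifP; lia. Qed.

Lemma cone_nonpos B (n : int) : n <= 0 -> cone B n = 0.
Proof.
move=> n0; rewrite /cone big1 // => t _; rewrite big1 // => w _; rewrite big1 // => j _.
case: ifP => // /and3P[t0 w0 /eqP e].
case: (eqVneq (edge t j) 0) => [->|/edge_bound tj]; first by rewrite !mul0r.
have h1 : 0 < t * w by rewrite mulr_gt0.
have h2 : 0 <= t * t - j * j by nia.
lia.
Qed.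

(** The theta series of 4 i^2 has constant term 1, hence can be cancelled: this is
    induction on n, where only i = 0 involves the value at n itself. *)
Lemma rep3_alt_cone B (n : int) : 10 * (n + 1) <= B%:Z -> rep3_alt B n = 2 * cone B n.
Proof.
move=> nB; have [h|n0] := leP n 0; first by rewrite rep3_alt_nonpos ?cone_nonpos.
have [k nk] : exists k : nat, n = k by exists (absz n); lia.
elim/ltn_ind: k n nk nB n0 => k IH n nk nB n0.
have IHn (x : int) : x < n -> rep3_alt B x = 2 * cone B x.
  move=> xm; have [h|x0] := leP x 0; first by rewrite rep3_alt_nonpos ?cone_nonpos.
  by apply: (IH (absz x)); lia.
have := cone_rep3_recursion nB; rewrite mulr_sumr => e.
have : \sum_(i <- box B) (2 * cone B (n - 4 * i * i) - rep3_alt B (n - 4 * i * i)) = 0.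
  by rewrite sumrB e subrr.
rewrite (@sum_single _ _ 0 (box_uniq B)); first by rewrite !mulr0 subr0; lia.
- by rewrite mem_box; lia.
- by move=> i i0; rewrite IHn ?subrr //; nia.
Qed.

Lemma sum_box_ge B (F : int -> int) a : (forall x, 0 <= F x) -> a \in box B ->
  F a <= \sum_(x <- box B) F x.
Proof.
move=> F0 ar; rewrite (bigD1_seq a) ?box_uniq //= lerDl; exact: sumr_ge0.
Qed.

Lemma mod8_2 (k : int) : ((8 * k + 2) %% 8)%Z == 2.
Proof. lia. Qed.
Lemma mod8_6 (k : int) : (((8 * k + 6) %% 8)%Z == 2) = false.
Proof. lia. Qed.
Lemma shift8 (x n b c y : int) : x = n - 8 * c + 8 * b -> x + 8 * c - 8 * b = y -> n = y.
Proof. lia. Qed.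

(** Since j and t are odd, 2 t w = n mod 8, so chi4 t * chi4 w depends on n only and
    there is no cancellation; the point t = 1, w = n / 2, j = 1 contributes. *)
Lemma cone_neq0 B (n : int) : 10 * (n + 1) <= B%:Z -> 0 < n -> (n %% 4)%Z = 2 -> cone B n != 0.
Proof.
move=> nB n0 n4.
pose e : int := if (n %% 8)%Z == 2 then 1 else -1.
pose h (t w j : int) : int :=
  if [&& 0 < t, 0 < w & t * t + 2 * (t * w) - j * j == n]
  then edge t j * odd_ind j * `|chi4 t * chi4 w| else 0.
have h0 t w j : 0 <= h t w j.
  by rewrite /h; case: ifP => // _; rewrite !mulr_ge0 // /edge /odd_ind; do !case: ifP.
have -> : cone B n = e * \sum_(t <- box B) \sum_(w <- box B) \sum_(j <- box B) h t w j.
  rewrite /cone mulr_sumr; apply: eq_bigr => t _; rewrite mulr_sumr; apply: eq_bigr => w _.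
  rewrite mulr_sumr; apply: eq_bigr => j _.
  rewrite /h; case: ifP => [/and3P[t0 w0 /eqP E]|]; last by rewrite mulr0.
  case: (eqVneq (odd_ind j) 0) => [->|/odd_ind_neq0 jo]; first by rewrite mulr0 !mul0r mulr0.
  rewrite [RHS]mulrCA; congr (_ * _).
  case: (eqVneq (chi4 t) 0) => [->|/chi4_odd to]; first by rewrite !mul0r normr0 mulr0.
  case: (eqVneq (chi4 w) 0) => [->|/chi4_odd wo]; first by rewrite !mulr0 ?normr0 ?mulr0.
  have [b jb] := odd_sqr_mod8 jo. have [c tc] := odd_sqr_mod8 to.
  have [u uE] : exists u : int, t = 4 * u + 1 \/ t = 4 * u + 3 by exists (t %/ 4)%Z; lia.
  have [v vE] : exists v : int, w = 4 * v + 1 \/ w = 4 * v + 3 by exists (w %/ 4)%Z; lia.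
  have c1E (x : int) : chi4 (4 * x + 1) = 1 by rewrite /chi4 ifT //; lia.
  have c3E (x : int) : chi4 (4 * x + 3) = -1 by rewrite /chi4 ifF ?ifT //; lia.
  have E2 : 2 * (t * w) = n - 8 * c + 8 * b by rewrite -E tc jb; ring.
  rewrite /e; case: uE E2 => ->; case: vE => ->; rewrite ?c1E ?c3E => E2.
  - rewrite (_ : n = 8 * (c - b + 4 * (u * v) + u + v) + 2) ?mod8_2 //.
    by apply: (shift8 E2); ring.
  - rewrite (_ : n = 8 * (c - b + 4 * (u * v) + 3 * u + v) + 6) ?mod8_6 //.
    by apply: (shift8 E2); ring.
  - rewrite (_ : n = 8 * (c - b + 4 * (u * v) + u + 3 * v) + 6) ?mod8_6 //.
    by apply: (shift8 E2); ring.
  - rewrite (_ : n = 8 * (c - b + 4 * (u * v) + 3 * u + 3 * v + 2) + 2) ?mod8_2 //.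
    by apply: (shift8 E2); ring.
have s1 : h 1 (n %/ 2)%Z 1 = 1.
  rewrite /h ifT; last by apply/and3P; split; lia.
  have -> : edge 1 1 * odd_ind 1 = 1 by [].
  have : (divz n 2 %% 2)%Z = 1 by lia.
  move: (divz n 2) => z zo; rewrite (_ : chi4 1 = 1) // !mul1r.
  rewrite /chi4; do !case: ifP; lia.
have b1 : 1 \in box B by rewrite mem_box; lia.
have b2 : (n %/ 2)%Z \in box B by rewrite mem_box; lia.
have q1 := @sum_box_ge B (fun t => \sum_(w <- box B) \sum_(j <- box B) h t w j) 1 _ b1.
have q2 := @sum_box_ge B (fun w => \sum_(j <- box B) h 1 w j) _ _ b2.
have q3 := @sum_box_ge B (fun j => h 1 (n %/ 2)%Z j) _ _ b1.
have p1 := le_trans (q3 (h0 _ _)) (le_trans (q2 (fun w => sumr_ge0 _ (fun j _ => h0 _ w j)))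
   (q1 (fun t => sumr_ge0 _ (fun w _ => sumr_ge0 _ (fun j _ => h0 t w j))))).
rewrite s1 in p1.
rewrite mulf_neq0 //; first by rewrite /e; case: ifP.
by apply: lt0r_neq0; apply: lt_le_trans p1.
Qed.

Lemma sum_neq0 (r : seq int) (F : int -> int) : \sum_(x <- r) F x != 0 ->
  exists x, F x != 0.
Proof.
elim: r => [|a r IH]; first by rewrite big_nil eqxx.
rewrite big_cons; case: (eqVneq (F a) 0) => [->|h _]; last by exists a.
by rewrite add0r.
Qed.

Lemma three_squares (n : int) : 0 < n -> (n %% 4)%Z = 2 ->
  exists x y z : int, n = x * x + y * y + z * z.
Proof.
move=> n0 n4; pose B := absz (10 * (n + 1)).
have nB : 10 * (n + 1) <= B%:Z by rewrite /B; lia.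
have : rep3_alt B n != 0 by rewrite rep3_alt_cone // mulf_neq0 // cone_neq0.
case/sum_neq0 => x /sum_neq0[y] /sum_neq0[z]; case: ifP => // /eqP <- _.
by exists x, y, (2 * z); ring.
Qed.

(** * Reduction to a ternary form *)

Lemma icosahedral_doubleZ (n : nat) :
  2 * (icosahedral n)%:Z = 5 * (n%:Z * n%:Z * n%:Z) - 5 * (n%:Z * n%:Z) + 2 * n%:Z.
Proof.
have := icosahedral_double n; rewrite !expnS expn0 muln1; lia.
Qed.

(** The terms of degree 1 and 3 in x cancel between the indices a + x and a - x. *)
Lemma eight_of_pairs (m : nat) (a x y z u v : int) :
  - (a - 1) <= x <= a - 1 -> - (a - 1) <= y <= a - 1 -> - (a - 1) <= z <= a - 1 ->
  0 < u -> 0 < v ->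
  2 * m%:Z = 6 * (5 * (a * a * a) - 5 * (a * a) + 2 * a) +
    10 * (3 * a - 1) * (x * x + y * y + z * z) +
    (5 * (u * u * u) - 5 * (u * u) + 2 * u) + (5 * (v * v * v) - 5 * (v * v) + 2 * v) ->
  exists n : 'I_8 -> nat,
    (forall i : 'I_8, (0 < n i)%N) /\ m = (\sum_(i < 8) icosahedral (n i))%N.
Proof.
move=> hx hy hz u0 v0 h.
pose s := [:: absz (a + x); absz (a - x); absz (a + y); absz (a - y);
              absz (a + z); absz (a - z); absz u; absz v].
exists (fun i => nth 0%N s i); split.
  by case=> -[|[|[|[|[|[|[|[|//]]]]]]]] _ /=; lia.
rewrite !big_ord_recr big_ord0 /= add0n.
have E t : 0 < t -> 2 * (icosahedral (absz t))%:Z = 5 * (t * t * t) - 5 * (t * t) + 2 * t.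
  by move=> t0; rewrite icosahedral_doubleZ; have -> : (absz t)%:Z = t by lia.
have e1 := E (a + x) ltac:(lia). have e2 := E (a - x) ltac:(lia).
have e3 := E (a + y) ltac:(lia). have e4 := E (a - y) ltac:(lia).
have e5 := E (a + z) ltac:(lia). have e6 := E (a - z) ltac:(lia).
have e7 := E u u0. have e8 := E v v0.
apply/eqP; rewrite -eqz_nat !PoszD; apply/eqP; apply: (@mulfI _ 2) => //.
rewrite !mulrDr e1 e2 e3 e4 e5 e6 e7 e8 h; ring.
Qed.

(** * Solving the congruence *)

(** The icosahedral number of index 1 + 2 x. *)
Definition icoP (x : int) : int := 1 + 7 * x + 20 * (x * x) + 20 * (x * x * x).
(** The icosahedral number of index 4 z. *)
Definition icoQ (z : int) : int := 4 * z - 40 * (z * z) + 160 * (z * z * z).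
(** If p and q are the derivatives of [icoP] at x and of [icoQ] at z, this is
    (p - 127 q / 4) / 20.  The factor 20 is available because 127 = 7 mod 20. *)
Definition slope_gap (x z : int) : int := - 6 + 2 * x + 3 * (x * x) + 127 * z - 762 * (z * z).

(** Modulo 2 the Jacobian matrix of the two functions with respect to x and z is
    lower triangular with odd diagonal: z affects the first one only through 4 z.  At
    each step the correction of x is chosen first, then that of z. *)
Lemma hensel_pair (k : nat) (R : int) : exists x z c d : int,
  icoP x + icoQ z - R = (2 ^+ k) * c /\ slope_gap x z = (2 ^+ k) * d.
Proof.
elim: k => [|k [x [z [c [d [e1 e2]]]]]].
  by exists 0, 0, (icoP 0 + icoQ 0 - R), (slope_gap 0 0); rewrite expr0 !mul1r.
set q : int := 2 ^+ k in e1 e2 *.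
have [del [c' ec]] : exists del c', c + 7 * del = 2 * c'.
  by exists (c %% 2)%Z, ((c + 7 * (c %% 2)%Z) %/ 2)%Z; lia.
pose t := d + del * (2 + 6 * x + 3 * (q * del)).
have [eps [d' ed]] : exists eps d', t + 127 * eps = 2 * d'.
  by exists (t %% 2)%Z, ((t + 127 * (t %% 2)%Z) %/ 2)%Z; lia.
exists (x + q * del), (z + q * eps).
exists (c' + del * (10 * (2 * x + q * del) + 10 * (3 * (x * x) + 3 * x * (q * del) + q * q * del * del))
  + eps * (2 - 20 * (2 * z + q * eps) + 80 * (3 * (z * z) + 3 * z * (q * eps) + q * q * eps * eps))).
exists (d' - 381 * eps * (2 * z + q * eps)).
rewrite exprS -/q; split.
  have -> : icoP (x + q * del) + icoQ (z + q * eps) - R =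
    (icoP x + icoQ z - R) + q * (7 * del + 2 * (del * (10 * (2 * x + q * del) + 10 * (3 * (x * x) + 3 * x * (q * del) + q * q * del * del))
  + eps * (2 - 20 * (2 * z + q * eps) + 80 * (3 * (z * z) + 3 * z * (q * eps) + q * q * eps * eps)))).
    by rewrite /icoP /icoQ; ring.
  by rewrite e1 -mulrDr addrA ec; ring.
have -> : slope_gap (x + q * del) (z + q * eps) = slope_gap x z + q * (t - d + 127 * eps - 2 * (381 * eps * (2 * z + q * eps))).
  by rewrite /t /slope_gap; ring.
rewrite e2 -mulrDr (_ : d + _ = (t + 127 * eps) - 2 * (381 * eps * (2 * z + q * eps))); last by ring.
by rewrite ed; ring.
Qed.

Lemma solve_linear_pow2 (k : nat) (w rho : int) : (w %% 2)%Z = 1 ->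
  exists kap c : int, [/\ 0 <= kap, kap < 2 ^+ k & rho + w * kap = (2 ^+ k) * c].
Proof.
move=> w1; elim: k => [|k [kap [c [h1 h2 h3]]]].
  by exists 0, rho; rewrite expr0 mulr0 addr0 mul1r.
rewrite exprS; set q : int := 2 ^+ k in h2 h3 *.
have [u uE] : exists u : int, w = 2 * u + 1 by exists (w %/ 2)%Z; lia.
have [c0|c1] : (exists c', c = 2 * c') \/ (exists c', c = 2 * c' + 1).
  have [h|h] : (c %% 2)%Z = 0 \/ (c %% 2)%Z = 1 by lia.
    by left; exists (c %/ 2)%Z; lia.
  by right; exists (c %/ 2)%Z; lia.
- by case: c0 => c' c0; exists kap, c'; split; [lia|lia|rewrite h3 c0; ring].
- case: c1 => c' c1; exists (kap + q), (c' + u + 1); split; [lia|lia|].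
by rewrite mulrDr addrA h3 c1 uE; ring.
Qed.

Lemma solve_mod5 (b t : int) : (b %% 5)%Z != 0 ->
  exists e c : int, [/\ 0 <= e, e < 5 & 8 * b * e - t = 5 * c].
Proof.
move=> b5; pose d := (b %/ 5)%Z.
have [bE|[bE|[bE|bE]]] : b = 5 * d + 1 \/ b = 5 * d + 2 \/ b = 5 * d + 3 \/ b = 5 * d + 4 by lia.
- by exists ((2 * t) %% 5)%Z, (8 * d * ((2 * t) %% 5)%Z + ((8 * ((2 * t) %% 5)%Z - t) %/ 5)%Z); split; lia.
- by exists ((1 * t) %% 5)%Z, (8 * d * ((1 * t) %% 5)%Z + ((16 * ((1 * t) %% 5)%Z - t) %/ 5)%Z); split; lia.
- by exists ((4 * t) %% 5)%Z, (8 * d * ((4 * t) %% 5)%Z + ((24 * ((4 * t) %% 5)%Z - t) %/ 5)%Z); split; lia.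
- by exists ((3 * t) %% 5)%Z, (8 * d * ((3 * t) %% 5)%Z + ((32 * ((3 * t) %% 5)%Z - t) %/ 5)%Z); split; lia.
Qed.

Lemma pow2_mod5 (i : nat) : ((2 ^+ i : int) %% 5)%Z != 0.
Proof. by elim: i => [|i IH] //; rewrite exprS; lia. Qed.

Lemma dvd5_cancel (b T Y : int) : (b %% 5)%Z != 0 -> 8 * (b * b) * T = 5 * Y -> exists T', T = 5 * T'.
Proof.
move=> b5 e; exists (T %/ 5)%Z; pose d := (b %/ 5)%Z.
have key r : b = 5 * d + r -> exists Y', 8 * (r * r) * T = 5 * Y'.
  move=> bE; exists (Y - 8 * (5 * d * d + 2 * d * r) * T).
  by rewrite mulrBr -e bE; ring.
have [bE|[bE|[bE|bE]]] : b = 5 * d + 1 \/ b = 5 * d + 2 \/ b = 5 * d + 3 \/ b = 5 * d + 4 by lia.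
all: by have [Y' h] := key _ bE; lia.
Qed.

Lemma residue_in_interval (b x0 lo : int) : 0 < b -> exists x w : int,
  [/\ lo <= x, x < lo + b & x = x0 + b * w].
Proof.
move=> b0; exists (lo + ((x0 - lo) %% b)%Z), (- ((x0 - lo) %/ b)%Z).
have h1 := divz_eq (x0 - lo) b.
have h2 := modz_ge0 (x0 - lo) (lt0r_neq0 b0).
have h3 := ltz_pmod (x0 - lo) b0.
split; lia.
Qed.

(** The point (x, z) of [hensel_pair] is first moved to the prescribed interval and
    to a solution modulo 5, which costs multiples of 4 b and b.  The second
    correction 20 b h1, 5 b h2 is then linear modulo 8 b^2 and proportional to
    127 h1 + h2 up to an odd factor, so division by 127 with remainder finds it. *)
Lemma local_solution (i : nat) (R Z0 : int) : let b : int := 2 ^+ i in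
  exists x z t : int, [/\ 0 <= x /\ 127 * x <= 2540 * b + 40 * (b * b),
    Z0 <= z /\ z <= Z0 + 631 * b & icoP x + icoQ z - R = 40 * (b * b) * t].
Proof.
move=> b; have b0 : 0 < b by rewrite exprn_gt0.
have b5 := pow2_mod5 i; rewrite -/b in b5.
have [x0 [z0 [c [d]]]] := hensel_pair i.+2 R.
rewrite !exprS mulrA -/b => -[e1 e2].
have inv := @solve_linear_pow2 i.+1; rewrite exprS -/b in inv; clearbody b.
have [z1 [w1 [hz1 hz1' z1E]]] := @residue_in_interval b z0 Z0 b0.
have [x1 [w2 [hx1 hx1' x1E]]] := @residue_in_interval (4 * b) x0 0 ltac:(lia).
have [e [c5 [he he' e5]]] := @solve_mod5 b (R - 1 - 2 * x1 - 4 * z1) b5.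
have [x2 x2E] : exists x2, x2 = x1 + 4 * b * e by exists (x1 + 4 * b * e).
have [c2 f1] : exists c2, icoP x2 + icoQ z1 - R = 4 * b * c2.
  pose w := w2 + e; have -> : x2 = x0 + 4 * b * w by rewrite x2E x1E /w; ring.
  exists (c + w * (7 + 20 * (2 * x0 + 4 * b * w) + 20 * (3 * (x0 * x0) + 3 * x0 * (4 * b * w) +
     4 * b * w * (4 * b * w))) + w1 * (1 - 10 * (2 * z0 + b * w1) + 40 * (3 * (z0 * z0) +
     3 * z0 * (b * w1) + b * w1 * (b * w1)))).
  by rewrite [RHS]mulrDr [X in _ = X + _]mulrDr -[4 * b * c]e1 z1E /icoP /icoQ; ring.
have [d2 f2] : exists d2, slope_gap x2 z1 = b * d2.
  pose w := w2 + e; have -> : x2 = x0 + 4 * b * w by rewrite x2E x1E /w; ring.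
  exists (4 * d + 4 * w * (2 + 3 * (2 * x0 + 4 * b * w)) + w1 * (127 - 762 * (2 * z0 + b * w1))).
  rewrite [RHS]mulrDr [X in _ = X + _]mulrDr (_ : b * (4 * d) = 4 * b * d); last by ring.
  by rewrite -[4 * b * d]e2 z1E /slope_gap; ring.
pose be := 1 - 20 * z1 + 120 * (z1 * z1).
have [kap [c3 []]] := inv (5 * be) c2 ltac:(rewrite /be; lia).
move=> k0 k1 f3.
(* Dividing by 127 keeps h2, hence the interval for z, short at the price of a
   longer range for x. *)
pose h1 := (kap %/ 127)%Z; pose h2 := (kap %% 127)%Z.
have kE : kap = 127 * h1 + h2 by rewrite /h1 /h2; lia.
have h1b : 0 <= h1 /\ 127 * h1 <= 2 * b by rewrite /h1; lia.
have h2b : 0 <= h2 <= 126 by rewrite /h2; lia.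
clearbody h1 h2.
pose x3 := x2 + 20 * b * h1; pose z3 := z1 + 5 * b * h2.
have [T f4] : exists T, icoP x3 + icoQ z3 - R = 8 * (b * b) * T.
  pose G := (h1 * h1 * 50 * (20 + 60 * x2) + 20000 * b * h1 * h1 * h1) +
    (25 * h2 * h2 * (- 5 + 60 * z1) + 2500 * b * h2 * h2 * h2).
  have E : icoP x3 + icoQ z3 - R = (icoP x2 + icoQ z1 - R) + 20 * b * (127 * h1 + h2) * be +
     400 * b * h1 * slope_gap x2 z1 + 8 * (b * b) * G.
    by rewrite /x3 /z3 /icoP /icoQ /slope_gap /be /G; ring.
  exists (c3 + 50 * h1 * d2 + G); apply: (etrans E).
  clearbody G be; rewrite f1 f2 -kE.
  transitivity (4 * b * (c2 + 5 * be * kap) + 400 * b * h1 * (b * d2) + 8 * (b * b) * G).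
    by ring.
  by rewrite f3; ring.
have [T' TE] : exists T', T = 5 * T'.
  apply: (@dvd5_cancel b T (c5 + x3 + 4 * (x3 * x3) + 4 * (x3 * x3 * x3) - 8 * (z3 * z3)
     + 32 * (z3 * z3 * z3) + (8 * b * h1 + 4 * b * h2)) b5).
  rewrite -f4; have -> : R = 2 * x1 + 1 + 4 * z1 + 8 * b * e - 5 * c5 by lia.
  by rewrite /icoP /icoQ /x3 /z3 x2E; ring.
exists x3, z3, T'; split.
- split; first by rewrite /x3 x2E !addr_ge0 ?mulr_ge0 //; lia.
  have be4 : b * e <= b * 4 by rewrite ler_wpM2l //; lia.
  have bh : b * (127 * h1) <= b * (2 * b) by rewrite ler_wpM2l //; lia.
  by rewrite /x3 x2E; lia.
- have bh : 0 <= b * h2 by rewrite mulr_ge0 //; lia.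
  have bh' : b * h2 <= b * 126 by rewrite ler_wpM2l //; lia.
  by rewrite /z3; lia.
- by rewrite f4 TE; ring.
Qed.

(** * Size of the two free terms *)

(** 64^i is b^6 for b = 2^i, and 8 * 64^19 = 2^117 < 10^36. *)
Lemma pick_pow64 (m : nat) : (10 ^ 36 <= m)%N ->
  exists i : nat, [/\ (19 <= i)%N, (8 * 64 ^ i <= m)%N & (m < 512 * 64 ^ i)%N].
Proof.
move=> hm; have h1 : (64 ^ 19 <= m %/ 8)%N by lia.
have m8 : (0 < m %/ 8)%N by lia.
exists (trunc_log 64 (m %/ 8)); split.
- exact: trunc_log_max h1.
- have := @trunc_logP 64 (m %/ 8) isT m8; clear h1 hm; lia.
- have := @trunc_log_ltn 64 (m %/ 8) isT; rewrite expnS; clear h1 hm; lia.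
Qed.

Lemma icoP_bound (b w x : int) : 1024 * 512 <= b -> w = b * b -> 0 <= x ->
  127 * x <= 2540 * b + 40 * w -> 0 <= icoP x /\ 10 * icoP x <= 7 * (w * w * w).
Proof.
move=> b0 wE x0 hx; have b1 : 0 <= b by lia.
have w1 : 1024 * 512 * b <= w by rewrite wE ler_wpM2r.
have w2 : 1000 * 1000 <= w by lia.
have w0 : 0 <= w by lia.
have x1 : 100 * x <= 32 * w by lia.
have x2 : 0 <= 100 * x by rewrite mulr_ge0.
clear hx w1 b0 b1 wE.
have xx : 0 <= x * x by rewrite mulr_ge0.
have xxx : 0 <= x * x * x by rewrite mulr_ge0.
split; first by rewrite /icoP; lia.
have h2 : (100 * x) * (100 * x) <= (32 * w) * (32 * w) by rewrite ler_pM.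
have h3 : (100 * x) * (100 * x) * (100 * x) <= (32 * w) * (32 * w) * (32 * w).
  by rewrite ler_pM // mulr_ge0.
have k3 : 1000 * 1000 * (w * w) <= w * w * w.
  by rewrite -(mulrA w w w) ler_wpM2r ?mulr_ge0.
have k2 : 1000 * 1000 * w <= w * w by rewrite ler_wpM2r.
rewrite /icoP; lia.
Qed.

Lemma icoQ_ge (z : int) : 0 <= z -> 120 * (z * z * z) <= icoQ z.
Proof.
move=> z0; have z1 : 0 <= z * (z - 1) by nia.
have : 0 <= z * (1 + 10 * (z * (z - 1))) by rewrite mulr_ge0 //; lia.
rewrite /icoQ; lia.
Qed.

Lemma icoQ_mono (y z : int) : 1 <= y -> y <= z -> icoQ y <= icoQ z.
Proof.
move=> y1 yz; have [D DE] : exists D : int, z = y + D by exists (z - y); lia.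
have D0 : 0 <= D by lia.
have DD : 0 <= D * D by rewrite mulr_ge0.
have h1 : 0 <= D * (y * (6 * y - 1)) by rewrite !mulr_ge0 //; lia.
have h2 : 0 <= D * D * (12 * y - 1) by rewrite !mulr_ge0 //; lia.
have h3 : 0 <= D * D * D by rewrite !mulr_ge0.
by rewrite DE /icoQ; lia.
Qed.

(** The main term is 480 y^2 D, at most 480 * 4 * 632 b w^2; it stays below 2.4 w^3
    because w >= 2^19 b. *)
Lemma icoQ_step (b w y D : int) : 1024 * 512 <= b -> w = b * b -> 0 <= y -> y <= 2 * w ->
  0 <= D -> D <= 632 * b -> 10 * (icoQ (y + D) - icoQ y) <= 24 * (w * w * w).
Proof.
move=> b0 wE y0 yw D0 Db.
have b1 : 0 <= b by lia.
have w0 : 0 <= w by rewrite wE mulr_ge0.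
have w1 : 1024 * 512 * b <= w by rewrite wE ler_wpM2r.
have yy : 0 <= y * y by rewrite mulr_ge0.
have DD : 0 <= D * D by rewrite mulr_ge0.
have yD : 0 <= y * D by rewrite mulr_ge0.
have y2 : y * y <= (2 * w) * (2 * w) by rewrite ler_pM.
have D2 : D * D <= (632 * b) * (632 * b) by rewrite ler_pM.
have h1 : D * (y * y) <= (632 * b) * ((2 * w) * (2 * w)) by rewrite ler_pM.
have h2 : (D * D) * y <= (632 * b) * (632 * b) * (2 * w) by rewrite ler_pM.
have h3 : (D * D) * D <= (632 * b) * (632 * b) * (632 * b) by rewrite ler_pM.
have E2 : (632 * b) * (632 * b) * (2 * w) = 632 * 632 * 2 * (w * w) by rewrite wE; ring.
have E3 : (632 * b) * (632 * b) * (632 * b) = 632 * 632 * 632 * (b * w) by rewrite wE; ring.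
rewrite {}E2 in h2; rewrite {}E3 in h3.
have ww : 0 <= w * w by rewrite mulr_ge0.
have bw : 0 <= b * w by rewrite mulr_ge0.
have k1 : 1024 * 512 * (b * (w * w)) <= w * w * w.
  by rewrite mulrA -(mulrA w w w) ler_wpM2r.
have k2 : 1024 * 512 * (w * w) <= b * (w * w) by rewrite ler_wpM2r.
have w2 : 1024 * 512 * 1024 <= w by clear - w1 b0; lia.
have k3 : 1024 * 512 * 1024 * (b * w) <= b * (w * w).
  rewrite (_ : b * (w * w) = w * (b * w)); last by ring.
  by rewrite ler_wpM2r.
have w3 : 1024 <= w by clear - w2; lia.
have k4 : b * 1024 <= b * w by apply: ler_wpM2l.
clear wE; rewrite /icoQ; lia.
Qed.

(** Z0 is the first Z >= 1 with m - I(4 Z) <= 8.8 w^3.  At Z0 - 1 the difference is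
    therefore at least 8 w^3, also when Z0 = 1, and along the interval it drops
    by at most 2.4 w^3 + 0.7 w^3. *)
Lemma size_window (b w m : int) : 1024 * 512 <= b -> w = b * b ->
  8 * (w * w * w) <= m -> m < 512 * (w * w * w) ->
  exists Z0 : int, 1 <= Z0 /\ forall z x, Z0 <= z -> z <= Z0 + 631 * b ->
    0 <= x -> 127 * x <= 2540 * b + 40 * w ->
    40 * (w * w * w) + 6 * w + 8 < 9 * (m - icoP x - icoQ z) /\
    10 * (m - icoP x - icoQ z) <= 88 * (w * w * w).
Proof.
move=> b0 wE hm1 hm2.
have b1 : 0 <= b by lia.
have w1 : 1024 * 512 * b <= w by rewrite wE ler_wpM2r.
have w0 : 0 <= w by lia.
have ww : 0 <= w * w by rewrite mulr_ge0.
have www : 0 <= w * w * w by rewrite mulr_ge0.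
have k1 : w <= w * w by rewrite ler_peMr //; lia.
have w3 : 1000 <= w by clear - w1 b0; lia.
have k2 : 1000 * (w * w) <= w * (w * w) by apply: ler_wpM2r.
rewrite mulrA in k2.
(* The index is shifted so that y = Z0 - 1 is the natural number k below. *)
pose p (k : nat) := 10 * (m - icoQ k.+1%:Z) <= 88 * (w * w * w).
have exp : exists k, p k.
  exists (absz m); rewrite /p; set t : int := (absz m).+1%:Z.
  have t1 : m <= t by rewrite /t; lia.
  have t2 : 1 <= t by rewrite /t; lia.
  have tt : t <= t * t * t.
    have h1 : t * 1 <= t * t by apply: ler_wpM2l => //; lia.
    have h2 : t * t * 1 <= t * t * t by apply: ler_wpM2l => //; apply: mulr_ge0; lia.
    clear - h1 h2; lia.
  have := @icoQ_ge t ltac:(lia); lia.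
case: (ex_minnP exp) => k pk kmin; exists k.+1%:Z; split; first by lia.
have yQ : 8 * (w * w * w) <= m - icoQ k%:Z.
  case: k pk kmin => [|k] pk kmin; first by rewrite /icoQ; lia.
  have : ~~ p k by apply/negP => /kmin; rewrite ltnn.
  rewrite /p -ltNge; lia.
have yw : k%:Z <= 2 * w.
  rewrite leNgt; apply/negP => yw.
  have := @icoQ_ge k ltac:(lia).
  have : (2 * w) * (2 * w) * (2 * w) <= k%:Z * k%:Z * k%:Z by rewrite !ler_pM ?mulr_ge0 //; lia.
  lia.
move=> z x z0 z1 x0 x1.
have [P0 P1] := icoP_bound b0 wE x0 x1.
have h1 := @icoQ_mono k.+1%:Z z ltac:(lia) z0.
have := @icoQ_step b w k%:Z (z - k%:Z) b0 wE ltac:(lia) yw ltac:(lia) ltac:(lia).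
rewrite (_ : k%:Z + (z - k%:Z) = z); last by ring.
move=> h2.
rewrite /p in pk; clear kmin exp p; split; lia.
Qed.

Lemma sq_bound (x N c : int) : 0 <= c -> x * x <= N -> N <= c * c -> - c <= x <= c.
Proof. nia. Qed.

(** So that a = (2 b^2 + 1) / 3 is an integer. *)
Lemma pow2_mod3 (i : nat) : exists a : int, 2 * ((2 ^+ i : int) * 2 ^+ i) + 1 = 3 * a.
Proof.
elim: i => [|i [a h]]; first by exists 1.
by exists (4 * a - 1); rewrite exprS; move: (2 ^+ i) h => q h; lia.
Qed.

Lemma pow2_64 (i : nat) (b := 2 ^+ i : int) : (b * b) * (b * b) * (b * b) = (64 ^ i)%N%:Z.
Proof.
rewrite {}/b; elim: i => [//|i IH]; rewrite exprS expnS.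
by move: (2 ^+ i) (64 ^ i)%N IH => q x IH; rewrite PoszM -IH; ring.
Qed.

(** Here 3 a - 1 = 2 w, and R is chosen such that
    m - 6 I(a) - I(u) - I(v) = 10 w (2 - 4 t), that is N = 2 - 4 t. *)
Lemma eight_icosahedral (m : nat) : (10 ^ 36 <= m)%N ->
  exists n : 'I_8 -> nat,
    (forall i : 'I_8, (0 < n i)%N) /\ m = (\sum_(i < 8) icosahedral (n i))%N.
Proof.
move=> /pick_pow64[i [i19 hm1 hm2]].
pose b : int := 2 ^+ i; pose w := b * b.
have [a aE] := pow2_mod3 i; rewrite -/b -/w in aE.
have www : w * w * w = (64 ^ i)%N%:Z.
  by rewrite /w /b pow2_64.
have b0 : 1024 * 512 <= b.
  rewrite /b -(subnK i19) exprD.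
  have -> : (2 ^+ 19 : int) = 1024 * 512 by rewrite (exprD _ 10 9).
  rewrite ler_peMl // exprn_ege1 //.
have [Z0 [Z01 hwin]] := @size_window b w m b0 erefl ltac:(lia) ltac:(lia).
pose R : int := m%:Z - 3 * (5 * (a * a * a) - 5 * (a * a) + 2 * a) - 20 * w.
have [x [z [t [[x0 x1] [z0 z1] e]]]] := local_solution i R Z0.
rewrite -/b -/w in x1 z1 e.
have [lo hi] := hwin z x z0 z1 x0 x1.
pose N := 2 - 4 * t.
have w0 : 1000 <= w by rewrite /w; nia.
have aE9 : 27 * (5 * (a * a * a) - 5 * (a * a) + 2 * a) = 40 * (w * w * w) + 6 * w + 8.
  have -> : 27 * (5 * (a * a * a) - 5 * (a * a) + 2 * a) =
    5 * ((3 * a) * (3 * a) * (3 * a)) - 15 * ((3 * a) * (3 * a)) + 18 * (3 * a) by ring.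
  by rewrite -aE; ring.
have NE : 10 * (w * N) = m%:Z - 3 * (5 * (a * a * a) - 5 * (a * a) + 2 * a) - icoP x - icoQ z.
  by rewrite /N; move: e; rewrite /R; lia.
have N0 : 0 < N.
  have : 0 < w * N by lia.
  by rewrite pmulr_rgt0 //; lia.
have Nle : N <= (a - 1) * (a - 1).
  have k2 : 1000 * (w * w) <= w * (w * w) by apply: ler_wpM2r => //; apply: mulr_ge0; lia.
  have h : 90 * (w * N) <= 10 * (w * ((2 * w - 2) * (2 * w - 2))) by lia.
  have h2 : w * (9 * N) <= w * ((2 * w - 2) * (2 * w - 2)) by lia.
  rewrite ler_pM2l in h2; last by lia.
  have E : (2 * w - 2) * (2 * w - 2) = 9 * ((a - 1) * (a - 1)).
    have -> : 2 * w - 2 = 3 * (a - 1) by lia.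
    by ring.
  lia.
have [p [q [r NEE]]] := @three_squares N N0 ltac:(rewrite /N; lia).
have a1 : 0 <= a - 1 by lia.
have pp : 0 <= p * p by rewrite -expr2 sqr_ge0.
have qq : 0 <= q * q by rewrite -expr2 sqr_ge0.
have rr : 0 <= r * r by rewrite -expr2 sqr_ge0.
apply: (@eight_of_pairs m a p q r (1 + 2 * x) (4 * z)).
- by apply: (@sq_bound _ N) => //; lia.
- by apply: (@sq_bound _ N) => //; lia.
- by apply: (@sq_bound _ N) => //; lia.
- lia.
- lia.
rewrite -NEE (_ : 3 * a - 1 = 2 * w); last by lia.
move: NE; rewrite /icoP /icoQ; lia.
Qed.

Local Open Scope nat_scope.

Theorem theorem1p5 (m : nat) (m_gt0 : 0 < m) (m_ge : 10 ^ 36 <= m) :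
  exists n : 'I_8 -> nat,
    (forall i : 'I_8, 0 < n i) /\ m = \sum_(i < 8) icosahedral (n i).
Proof. exact: eight_icosahedral. Qed.
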